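(* For every integer $m \ge 0$ and every real $u > 0$, the generalised Stieltjes constant $\gamma_m(u)$ satisfies $$\gamma_m(u) = -\frac{1}{m+1}\sum_{n=0}^{\infty}\frac{1}{n+1}\sum_{k=0}^{n}\binom{n}{k}(-1)^k \log^{m+1}(u+k).$$
   Context: Let $\zeta(s,u)$ denote the Hurwitz zeta function, i.e. the meromorphic continuation in $s$ of $\sum_{n=0}^\infty (n+u)^{-s}$ ($\operatorname{Re}(s)>1$), $u>0$. The generalised Stieltjes constants $\gamma_p(u)$, $p=0,1,2,\dots$, are defined by the Laurent expansion about $s=1$: $$\zeta(s,u)=\frac{1}{s-1}+\sum_{p=0}^{\infty}\frac{(-1)^p}{p!}\gamma_p(u)(s-1)^p .$$ Here $\log^{m+1}(y)$ means $(\log y)^{m+1}$. The double sum is an iterated sum: the inner finite sum over $k$ is computed first, then the series over $n$. *)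

(* Defs.v *)
(* Stdlib real numbers, with Coquelicot for complex numbers, derivatives and
   series. *)
From Stdlib Require Import Reals Factorial.
From Coquelicot Require Import Coquelicot.

Local Open Scope R_scope.

Definition Cexp (z : C) : C :=
  (exp (Re z) * cos (Im z), exp (Re z) * sin (Im z)).

(* [x ^ s] with complex exponent, meaningful for [0 < x]. *)
Definition Rpow_C (x : R) (s : C) : C := Cexp (s * RtoC (ln x))%C.

Definition holomorphic_at (g : C -> C) (z : C) : Prop :=
  locally z (fun w => @ex_derive C_AbsRing C_NormedModule g w).

(* Near each point, [f] is a holomorphic function divided by a power of
   [z - z0]. The value of [f] at [z0] itself is unconstrained, since [f] is
   total and has to take some value at its poles. *)
Definition meromorphic (f : C -> C) : Prop :=
  forall z0 : C, exists (n : nat) (g : C -> C),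
    holomorphic_at g z0 /\
    locally' z0 (fun z => f z = (g z / (z - z0) ^ n)%C).

(* [zeta] is a meromorphic continuation to the whole plane of
   [s |-> \sum_(n >= 0) (n + u) ^ (- s)], [Re s > 1]. By the identity theorem
   it is unique up to its values on a discrete set. *)
Definition is_hurwitz_zeta (u : R) (zeta : C -> C) : Prop :=
  meromorphic zeta /\
  forall s : C, 1 < Re s ->
    @is_series C_AbsRing C_NormedModule
      (fun n : nat => Rpow_C (INR n + u) (- s)%C) (zeta s).

(* Laurent expansion in a punctured neighbourhood of [s = 1]:
   [zeta s = 1 / (s - 1) + \sum_p (-1)^p / p! * gamma p * (s - 1)^p].
   The coefficients are complex a priori. *)
Definition is_stieltjes_constants (u : R) (gamma : nat -> C) : Prop :=
  exists zeta : C -> C,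
    is_hurwitz_zeta u zeta /\
    locally' (RtoC 1) (fun s : C =>
      @is_pseries C_AbsRing C_NormedModule
        (fun p : nat => (RtoC ((-1) ^ p / INR (fact p)) * gamma p)%C)
        (s - 1)%C
        (zeta s - 1 / (s - 1))%C).

(* Main.v *)
Require Import Defs.
From Stdlib Require Import Reals Lra Lia Factorial.
From Coquelicot Require Import Coquelicot.

(* Let [E] be the unit shift, [D] the derivative, and
   [S f u = \sum_n (1 - E)^n f u / (n + 1)], formally [D / (E - 1)]. For [f = ln^j]
   the Newton series [f' = - \sum_(n >= 1) (1 - E)^n f / n] gives
   [S f u - S f (u + 1) = - f' u], and [S f (u + K) - f (u + K)] tends to [0], so
   [S f u] is the limit [T f] of [f (u + K) - \sum_(k < K) f' (u + k)]. Both facts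
   need only the size of the differences of [ln^j]: they are [O (n^(- u) log^c n)],
   by induction on [j] from the Leibniz rule for divided differences.

   On the other hand [T (x^(- e)) = e * zeta (1 + e)]. The [e]-Taylor remainder [r] of
   order [n] of [x^(- e)] has [r'' = O (e^n)] summably in [x], hence
   [T r = O (e^n)] and [e * zeta (1 + e) = \sum_(j < n) (- e)^j / j! S (ln^j) u + O (e^n)].
   Comparing with the Laurent expansion for real [e > 0] gives the theorem. *)

(** [S] applied to x^(- e) is Hasse's series for e * zeta (1 + e). Differentiating it term by term
    at e = 0 would require bounds on all differences of x^(- e), uniform in e. Expanding x^(- e)
    before summing avoids this: [S] is applied only to the powers ln^j, while the remainder goes
    through [T], where f (x + 1) - f x - f' x is controlled by f'' alone.

    That the Newton series converges to f' has to be proved. Its remainder is a divided difference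
    with the node x doubled, so the induction on j that bounds the ordinary differences bounds it as
    well.

    The base of that induction is 1/x: its n-th normalised difference is exactly 1/(x (x+1) ...
    (x+n)), and n! times this has order n^(- x). The differences of ln follow by comparing
    derivatives. Each further factor ln costs only a logarithm of the largest node, which is
    absorbed by giving up part of the exponent. *)

Local Open Scope R_scope.

(** * Divided differences with unit step *)

(* [(1 - E)^n f x / n!] with [E] the unit shift, i.e. [(-1)^n f[x, x+1, ..., x+n]]. *)
Fixpoint ndiff (n : nat) (f : R -> R) (x : R) : R :=
  match n with
  | O => f x
  | S n => (ndiff n f x - ndiff n f (x + 1)) / INR (S n)
  end.

(* [n! * nrem n f (f' x) x] is the defect [f' x + \sum_(1 <= i <= n) (1 - E)^i f x / i] of
   the truncated Newton series; [nrem n f (f' x) x = (-1)^n f[x, x, x+1, ..., x+n]], which is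
   why it obeys a Leibniz rule. *)
Fixpoint nrem (n : nat) (f : R -> R) (v x : R) : R :=
  match n with
  | O => v
  | S n => (nrem n f v x + ndiff (S n) f x) / INR (S n)
  end.

(** Reciprocal of the rising factorial x (x+1) ... (x+n-1). It serves as majorant for the
    differences of powers of [ln] because [ipoch_add] splits it along the two blocks of nodes of a
    Leibniz summand. *)
Fixpoint ipoch (n : nat) (x : R) : R :=
  match n with
  | O => 1
  | S n => ipoch n x * / (x + INR n)
  end.

(** Leibniz rule for divided differences: one factor uses the nodes x, ..., x+k, the other x+k, ...,
    x+n. The signs agree since (-1)^n = (-1)^k (-1)^(n-k). *)
Lemma ndiff_mul (f g : R -> R) (n : nat) : forall x,
  ndiff n (fun y => f y * g y) x =
  sum_f_R0 (fun k => ndiff k f x * ndiff (n - k) g (x + INR k)) n.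
Proof.
  induction n as [|n IH]; intros x.
  { simpl. rewrite Rplus_0_r. reflexivity. }
  set (t := fun k => ndiff k f x * ndiff (S n - k) g (x + INR k)).
  assert (Hn : INR (S n) <> 0) by (apply not_0_INR; lia).
  assert (E : ndiff n (fun y => f y * g y) x - ndiff n (fun y => f y * g y) (x + 1)
          = INR (S n) * sum_f_R0 t (S n)).
  { rewrite !IH, <- minus_sum.
    (* Inserting [ndiff k f x * ndiff (n - k) g (x + INR k + 1)] splits the difference of the k-th
       summands at x and x+1. After summation [t k] carries the weight (n+1-k) + k = n+1. *)
    rewrite (sum_eq _ (fun k => INR (S n - k) * t k + INR (S k) * t (S k))).
    - rewrite sum_plus.
      assert (E1 : sum_f_R0 (fun k => INR (S n - k) * t k) n
              = sum_f_R0 (fun k => INR (S n - k) * t k) (S n)).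
      { rewrite tech5, Nat.sub_diag. simpl (INR 0). ring. }
      assert (E2 : sum_f_R0 (fun k => INR (S k) * t (S k)) n
              = sum_f_R0 (fun k => INR k * t k) (S n)).
      { rewrite (decomp_sum (fun k => INR k * t k)) by lia.
        simpl (INR 0). simpl pred. ring. }
      rewrite E1, E2, <- sum_plus, scal_sum.
      apply sum_eq. intros i Hi. rewrite minus_INR by lia. ring.
    - intros k Hk. unfold t.
      replace (S n - S k)%nat with (n - k)%nat by lia.
      replace (S n - k)%nat with (S (n - k)) by lia.
      rewrite (S_INR k).
      replace (x + (INR k + 1)) with (x + INR k + 1) by ring.
      replace (x + 1 + INR k) with (x + INR k + 1) by ring.
      assert (H1 : INR (S (n - k)) * ndiff (S (n - k)) g (x + INR k)
              = ndiff (n - k) g (x + INR k) - ndiff (n - k) g (x + INR k + 1)).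
      { cbn [ndiff]. field. apply not_0_INR; lia. }
      assert (H2 : (INR k + 1) * ndiff (S k) f x = ndiff k f x - ndiff k f (x + 1)).
      { cbn [ndiff]. rewrite <- S_INR. field. apply not_0_INR; lia. }
      transitivity (ndiff k f x * (INR (S (n - k)) * ndiff (S (n - k)) g (x + INR k))
        + ((INR k + 1) * ndiff (S k) f x) * ndiff (n - k) g (x + INR k + 1)); [|ring].
      rewrite H1, H2. ring. }
  change (ndiff (S n) (fun y => f y * g y) x) with
    ((ndiff n (fun y => f y * g y) x - ndiff n (fun y => f y * g y) (x + 1)) / INR (S n)).
  rewrite E. unfold t. field. exact Hn.
Qed.

(** Leibniz rule on the nodes x, x, x+1, ..., x+n: the leading term is cut at the first copy of x,
    the others at x+k. The product rule supplies the value at the doubled node. *)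
Lemma nrem_mul (f g : R -> R) (vf vg x : R) (n : nat) :
  nrem n (fun y => f y * g y) (vf * g x + f x * vg) x =
  f x * nrem n g vg x
  + sum_f_R0 (fun k => nrem k f vf x * ndiff (n - k) g (x + INR k)) n.
Proof.
  induction n as [|n IH].
  { simpl. rewrite Rplus_0_r. ring. }
  assert (Hn : INR (S n) <> 0) by (apply not_0_INR; lia).
  set (t := fun k => nrem k f vf x * ndiff (S n - k) g (x + INR k)).
  assert (E : nrem n (fun y => f y * g y) (vf * g x + f x * vg) x
       + ndiff (S n) (fun y => f y * g y) x
       = f x * (nrem n g vg x + ndiff (S n) g x) + INR (S n) * sum_f_R0 t (S n)).
  (* The k = 0 term of the Leibniz sum for [ndiff (S n)] joins the leading term. The rest is shifted
     by one index, and the weights add up to n+1 as in [ndiff_mul]. *)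
  { rewrite IH, ndiff_mul, (decomp_sum _ (S n)) by lia.
    change (ndiff 0 f x) with (f x). rewrite Nat.sub_0_r.
    replace (x + INR 0) with x by (simpl; ring). simpl pred.
    match goal with |- _ + ?A + (_ + ?B) = _ =>
      enough (A + B = INR (S n) * sum_f_R0 t (S n)) by lra end.
    rewrite <- sum_plus.
    rewrite (sum_eq _ (fun k => INR (S n - k) * t k + INR (S k) * t (S k))).
    - rewrite sum_plus.
      assert (E1 : sum_f_R0 (fun k => INR (S n - k) * t k) n
              = sum_f_R0 (fun k => INR (S n - k) * t k) (S n)).
      { rewrite tech5, Nat.sub_diag. simpl (INR 0). ring. }
      assert (E2 : sum_f_R0 (fun k => INR (S k) * t (S k)) n
              = sum_f_R0 (fun k => INR k * t k) (S n)).
      { rewrite (decomp_sum (fun k => INR k * t k)) by lia.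
        simpl (INR 0). simpl pred. ring. }
      rewrite E1, E2, <- sum_plus, scal_sum.
      apply sum_eq. intros i Hi. rewrite minus_INR by lia. ring.
    - intros k Hk. unfold t.
      replace (S n - S k)%nat with (n - k)%nat by lia.
      replace (S n - k)%nat with (S (n - k)) by lia.
      rewrite (S_INR k).
      replace (x + (INR k + 1)) with (x + INR k + 1) by ring.
      assert (H1 : INR (S (n - k)) * ndiff (S (n - k)) g (x + INR k)
              = ndiff (n - k) g (x + INR k) - ndiff (n - k) g (x + INR k + 1)).
      { cbn [ndiff]. field. apply not_0_INR; lia. }
      assert (H2 : (INR k + 1) * nrem (S k) f vf x = nrem k f vf x + ndiff (S k) f x).
      { cbn [nrem]. rewrite <- S_INR. field. apply not_0_INR; lia. }
      transitivity (nrem k f vf x * (INR (S (n - k)) * ndiff (S (n - k)) g (x + INR k))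
        + ((INR k + 1) * nrem (S k) f vf x) * ndiff (n - k) g (x + INR k + 1)); [|ring].
      rewrite H1, H2. ring. }
  change (nrem (S n) (fun y => f y * g y) (vf * g x + f x * vg) x) with
    ((nrem n (fun y => f y * g y) (vf * g x + f x * vg) x
       + ndiff (S n) (fun y => f y * g y) x) / INR (S n)).
  rewrite E. change (nrem (S n) g vg x) with ((nrem n g vg x + ndiff (S n) g x) / INR (S n)).
  unfold t. field. exact Hn.
Qed.

Lemma ndiff_binomial (f : R -> R) (n : nat) : forall x,
  INR (fact n) * ndiff n f x =
  sum_f_R0 (fun k => Binomial.C n k * (-1) ^ k * f (x + INR k)) n.
Proof.
  induction n as [|n IH]; intros x.
  { simpl. rewrite Rplus_0_r. unfold Binomial.C. simpl. field. }
  assert (Hn : INR (S n) <> 0) by (apply not_0_INR; lia).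
  transitivity (INR (fact n) * ndiff n f x - INR (fact n) * ndiff n f (x + 1)).
  { rewrite fact_simpl, mult_INR. cbn [ndiff]. field. exact Hn. }
  rewrite !IH.
  assert (C0 : forall q, Binomial.C q 0 = 1).
  { intros q. unfold Binomial.C. rewrite Nat.sub_0_r. simpl (fact 0). simpl (INR 1).
    field. apply INR_fact_neq_0. }
  assert (C1 : forall q, Binomial.C q q = 1).
  { intros q. unfold Binomial.C. rewrite Nat.sub_diag. simpl (fact 0). simpl (INR 1).
    field. apply INR_fact_neq_0. }
  destruct n as [|n].
  { simpl. rewrite !C0, C1. replace (x + 1 + 0) with (x + 1) by ring. ring. }
  rewrite (decomp_sum _ (S (S n))) by lia. simpl pred.
  rewrite (tech5 (fun i => Binomial.C (S (S n)) (S i) * (-1) ^ S i * f (x + INR (S i))) n).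
  rewrite (decomp_sum (fun k => Binomial.C (S n) k * (-1) ^ k * f (x + INR k)) (S n)) by lia.
  simpl pred.
  rewrite (tech5 (fun k => Binomial.C (S n) k * (-1) ^ k * f (x + 1 + INR k)) n).
  rewrite !C0, !C1.
  rewrite (sum_eq (fun i => Binomial.C (S (S n)) (S i) * (-1) ^ S i * f (x + INR (S i)))
    (fun i => Binomial.C (S n) (S i) * (-1) ^ S i * f (x + INR (S i))
       - Binomial.C (S n) i * (-1) ^ i * f (x + 1 + INR i))).
  - rewrite minus_sum.
    replace (x + INR (S (S n))) with (x + 1 + INR (S n)) by (rewrite (S_INR (S n)); ring).
    change ((-1) ^ (S (S n))) with (-1 * (-1) ^ (S n)). ring.
  - intros i Hi. rewrite <- (pascal (S n) i) by lia.
    replace (x + 1 + INR i) with (x + INR (S i)) by (rewrite S_INR; ring).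
    change ((-1) ^ (S i)) with (-1 * (-1) ^ i). ring.
Qed.

(** * Reciprocal rising factorials and the differences of 1/x *)

Lemma ipoch_pos (n : nat) (x : R) : 0 < x -> 0 < ipoch n x.
Proof.
  intros Hx. induction n as [|n IH]; cbn [ipoch]; [lra|].
  apply Rmult_lt_0_compat; [exact IH|].
  apply Rinv_0_lt_compat. generalize (pos_INR n); lra.
Qed.

Lemma ipoch_add (k n : nat) (x : R) :
  ipoch (k + n) x = ipoch k x * ipoch n (x + INR k).
Proof.
  induction n as [|n IH].
  { rewrite Nat.add_0_r. cbn [ipoch]. ring. }
  rewrite Nat.add_succ_r. cbn [ipoch].
  rewrite IH, plus_INR, <- Rplus_assoc. ring.
Qed.

Lemma ipoch_shift (n : nat) (x : R) : ipoch (S n) x = / x * ipoch n (x + 1).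
Proof.
  change (S n) with (1 + n)%nat. rewrite ipoch_add. simpl.
  rewrite Rplus_0_r. ring.
Qed.

Lemma ndiff_Rinv (n : nat) : forall x, 0 < x -> ndiff n Rinv x = ipoch (S n) x.
Proof.
  induction n as [|n IH]; intros x Hx.
  { simpl. rewrite Rplus_0_r. ring. }
  assert (Hn := pos_INR n).
  cbn [ndiff]. rewrite !IH by lra.
  rewrite (ipoch_shift n x).
  change (ipoch (S n) (x + 1)) with (ipoch n (x + 1) * / (x + 1 + INR n)).
  rewrite (ipoch_shift (S n) x).
  change (ipoch (S n) (x + 1)) with (ipoch n (x + 1) * / (x + 1 + INR n)).
  rewrite S_INR. field. lra.
Qed.

Lemma nrem_Rinv (n : nat) (x : R) : 0 < x ->
  nrem n Rinv (- / (x * x)) x = - (ipoch (S n) x / x).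
Proof.
  intros Hx. induction n as [|n IH].
  { simpl. rewrite Rplus_0_r. field. lra. }
  assert (Hn := pos_INR n).
  cbn [nrem]. rewrite IH, ndiff_Rinv by lra.
  change (ipoch (S (S n)) x) with (ipoch (S n) x * / (x + INR (S n))).
  rewrite S_INR. field. lra.
Qed.

Lemma is_derive_ndiff (f g : R -> R) (n : nat) :
  (forall x, 0 < x -> is_derive f x (g x)) ->
  forall x, 0 < x -> is_derive (ndiff n f) x (ndiff n g x).
Proof.
  intros H. induction n as [|n IH]; intros x Hx; [exact (H x Hx)|].
  cbn [ndiff].
  apply (is_derive_ext (fun y => scal (/ INR (S n)) (minus (ndiff n f y) (ndiff n f (y + 1))))).
  { intros t. unfold scal, minus, plus, opp; simpl. unfold mult; simpl. unfold Rdiv. ring. }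
  replace ((ndiff n g x - ndiff n g (x + 1)) / INR (S n))
    with (scal (/ INR (S n)) (minus (ndiff n g x) (ndiff n g (x + 1))))
    by (unfold scal, minus, plus, opp; simpl; unfold mult; simpl; unfold Rdiv; ring).
  apply is_derive_scal. apply @is_derive_minus; [apply IH; exact Hx|].
  replace (ndiff n g (x + 1)) with (scal 1 (ndiff n g (x + 1))) by (apply Rmult_1_l).
  apply (is_derive_comp (ndiff n f) (fun y => y + 1)); [apply IH; lra|].
  auto_derive; auto.
Qed.

(** Differencing commutes with differentiation, so [ln] with value [/ x] at the doubled node becomes
    [Rinv] with value [- / (x * x)], where [nrem_Rinv] is explicit. *)
Lemma is_derive_nrem (f g dg : R -> R) (n : nat) :
  (forall x, 0 < x -> is_derive f x (g x)) ->
  (forall x, 0 < x -> is_derive g x (dg x)) ->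
  forall x, 0 < x -> is_derive (fun y => nrem n f (g y) y) x (nrem n g (dg x) x).
Proof.
  intros Hf Hg. induction n as [|n IH]; intros x Hx; [exact (Hg x Hx)|].
  cbn [nrem].
  apply (is_derive_ext (fun y => scal (/ INR (S n)) (plus (nrem n f (g y) y) (ndiff (S n) f y)))).
  { intros t. unfold scal, plus; simpl. unfold mult; simpl. unfold Rdiv. ring. }
  replace ((nrem n g (dg x) x + ndiff (S n) g x) / INR (S n))
    with (scal (/ INR (S n)) (plus (nrem n g (dg x) x) (ndiff (S n) g x)))
    by (unfold scal, plus; simpl; unfold mult; simpl; unfold Rdiv; ring).
  apply is_derive_scal. apply @is_derive_plus; [apply IH; exact Hx|].
  apply is_derive_ndiff; assumption.
Qed.

Lemma is_derive_ln' (x : R) : 0 < x -> is_derive ln x (/ x).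
Proof. intros Hx. auto_derive; [exact Hx|field; lra]. Qed.

Lemma is_derive_Rinv (x : R) : 0 < x -> is_derive Rinv x (- / (x * x)).
Proof. intros Hx. auto_derive; [lra|field; lra]. Qed.

(** * Differences of the logarithm *)

Lemma mean_value (f df : R -> R) (a b : R) : a <= b ->
  (forall x, a <= x <= b -> is_derive f x (df x)) ->
  exists c, a <= c <= b /\ f b - f a = df c * (b - a).
Proof.
  intros Hab H.
  destruct (MVT_gen f a b df) as [c Hc].
  - rewrite Rmin_left, Rmax_right by exact Hab. intros x Hx. apply H. lra.
  - rewrite Rmin_left, Rmax_right by exact Hab. intros x Hx.
    apply derivable_continuous_pt. exists (df x). apply is_derive_Reals, H, Hx.
  - rewrite Rmin_left, Rmax_right in Hc by exact Hab. exists c. exact Hc.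
Qed.

(** Takes the place of integrating the derivative from x to infinity: f x dominates every f (x + k),
    so a limit along integer translates is enough. *)
Lemma nonneg_of_decreasing_to_0 (f : R -> R) :
  (forall x, 0 < x -> exists l, is_derive f x l /\ l <= 0) ->
  (forall x, 0 < x -> is_lim_seq (fun k => f (x + INR k)) 0) ->
  forall x, 0 < x -> 0 <= f x.
Proof.
  intros Hd Hl x Hx.
  assert (Hle : forall k : nat, f (x + INR k) <= f x).
  { intros k. assert (Hk := pos_INR k).
    destruct (mean_value f (Derive f) x (x + INR k)) as [c [Hc E]]; [lra| |].
    - intros y Hy. destruct (Hd y) as [l [Hl' _]]; [lra|].
      apply Derive_correct. exists l; exact Hl'.
    - destruct (Hd c) as [l [Hl' Hl0]]; [lra|].
      rewrite (is_derive_unique _ _ _ Hl') in E.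
      assert (l * (x + INR k - x) <= 0); [|lra].
      replace (x + INR k - x) with (INR k) by ring.
      rewrite <- (Rmult_0_l (INR k)). apply Rmult_le_compat_r; assumption. }
  exact (is_lim_seq_le _ _ _ _ Hle (Hl x Hx) (is_lim_seq_const (f x))).
Qed.

(** The logarithmic derivative is minus the sum of the n terms 1/(x+i), i < n. Each is at least
    1/(x+n), which gives the first bound; the term i = 0 alone gives the second. *)
Lemma ipoch_derive (n : nat) (x : R) : 0 < x ->
  exists l, is_derive (ipoch n) x l /\ l <= - (INR n * ipoch (S n) x)
    /\ ((1 <= n)%nat -> l <= - (ipoch n x / x)).
Proof.
  intros Hx. induction n as [|n IH].
  { exists 0. split; [exact (is_derive_const 1 x)|]. split; [simpl; lra|lia]. }
  destruct IH as [l [Hl [H1 H2]]].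
  assert (Hn := pos_INR n). assert (Hp := ipoch_pos n x Hx).
  assert (Hi : 0 < / (x + INR n)) by (apply Rinv_0_lt_compat; lra).
  exists (l * / (x + INR n) - ipoch n x * (/ (x + INR n) * / (x + INR n))).
  split; [|split].
  - cbn [ipoch].
    replace (l * / (x + INR n) - ipoch n x * (/ (x + INR n) * / (x + INR n)))
      with (plus (mult l (/ (x + INR n))) (mult (ipoch n x) (- (/ (x + INR n) * / (x + INR n)))))
      by (unfold plus, mult; simpl; ring).
    apply (is_derive_mult (ipoch n) (fun y => / (y + INR n)) x).
    + exact Hl.
    + auto_derive; [lra|field; lra].
    + exact Rmult_comm.
  - cbn [ipoch] in H1 |- *.
    set (p := ipoch n x) in *. set (i := / (x + INR n)) in *.
    assert (Hj : / (x + INR (S n)) <= i).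
    { apply Rinv_le_contravar; [lra|]. rewrite S_INR. lra. }
    assert (l * i <= - (INR n * (p * i)) * i) by (apply Rmult_le_compat_r; lra).
    assert (INR (S n) * (p * i) * / (x + INR (S n)) <= INR (S n) * (p * i) * i).
    { apply Rmult_le_compat_l; [|exact Hj].
      apply Rmult_le_pos; [apply pos_INR|]. apply Rmult_le_pos; lra. }
    rewrite S_INR in *. lra.
  - intros _. cbn [ipoch]. set (p := ipoch n x) in *. set (i := / (x + INR n)) in *.
    destruct n as [|n].
    + unfold p, i. simpl ipoch. simpl INR. rewrite Rplus_0_r.
      assert (l <= 0) by (simpl in H1; lra).
      assert (Hix : 0 < / x) by (apply Rinv_0_lt_compat; lra).
      assert (l * / x <= 0).
      { rewrite <- (Rmult_0_l (/ x)). apply Rmult_le_compat_r; lra. }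
      unfold Rdiv. lra.
    + assert (l <= - (p / x)) by (apply H2; lia).
      assert (l * i <= - (p / x) * i) by (apply Rmult_le_compat_r; lra).
      assert (0 <= p * (i * i)) by (apply Rmult_le_pos; [lra|]; apply Rmult_le_pos; lra).
      unfold Rdiv in *. lra.
Qed.

Lemma is_lim_seq_inv_shift (x : R) : is_lim_seq (fun k => / (x + INR k)) 0.
Proof.
  replace (Finite 0) with (Rbar_inv p_infty) by reflexivity.
  apply is_lim_seq_inv; [|discriminate].
  apply (is_lim_seq_ext (fun k => INR k + x)); [intros; ring|].
  eapply is_lim_seq_plus; [apply is_lim_seq_INR|apply is_lim_seq_const|reflexivity].
Qed.

Lemma is_lim_seq_0_scal (a : R) (u : nat -> R) :
  is_lim_seq u 0 -> is_lim_seq (fun n => a * u n) 0.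
Proof.
  intros H. replace (Finite 0) with (Rbar_mult a 0) by (simpl; f_equal; ring).
  apply is_lim_seq_scal_l, H.
Qed.

Lemma is_lim_seq_0_plus (u v : nat -> R) :
  is_lim_seq u 0 -> is_lim_seq v 0 -> is_lim_seq (fun n => u n + v n) 0.
Proof.
  intros Hu Hv. replace (Finite 0) with (Finite (0 + 0)) by (f_equal; ring).
  apply is_lim_seq_plus'; assumption.
Qed.

Lemma is_lim_seq_0_bound (u v : nat -> R) :
  (forall n, Rabs (u n) <= v n) -> is_lim_seq v 0 -> is_lim_seq u 0.
Proof.
  intros H Hv. apply is_lim_seq_abs_0.
  apply (is_lim_seq_le_le (fun _ => 0) _ v).
  - intros n. split; [apply Rabs_pos|apply H].
  - apply is_lim_seq_const.
  - exact Hv.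
Qed.

Lemma ipoch_lim (n : nat) (x : R) : 0 < x ->
  is_lim_seq (fun k => ipoch (S n) (x + INR k)) 0.
Proof.
  intros Hx. induction n as [|n IH].
  - apply (is_lim_seq_ext (fun k => / (x + INR k))); [|apply is_lim_seq_inv_shift].
    intros k. simpl. rewrite Rplus_0_r. ring.
  - apply (is_lim_seq_0_bound _ (fun k => / x * ipoch (S n) (x + INR k)));
      [|apply is_lim_seq_0_scal, IH].
    intros k. assert (Hk := pos_INR k).
    rewrite Rabs_right by (apply Rle_ge, Rlt_le, ipoch_pos; lra).
    change (ipoch (S (S n)) (x + INR k))
      with (ipoch (S n) (x + INR k) * / (x + INR k + INR (S n))).
    rewrite Rmult_comm. apply Rmult_le_compat_r; [apply Rlt_le, ipoch_pos; lra|].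
    apply Rinv_le_contravar; [exact Hx|]. generalize (pos_INR (S n)); lra.
Qed.

Lemma ndiff_ln_lim (n : nat) : forall x, 0 < x ->
  is_lim_seq (fun k => ndiff (S n) ln (x + INR k)) 0.
Proof.
  induction n as [|n IH]; intros x Hx.
  - apply (is_lim_seq_0_bound _ (fun k => / (x + INR k))); [|apply is_lim_seq_inv_shift].
    intros k. assert (Hk := pos_INR k). simpl.
    destruct (mean_value ln Rinv (x + INR k) (x + INR k + 1)) as [c [Hc E]]; [lra| |].
    { intros y Hy. apply is_derive_ln'. lra. }
    replace ((ln (x + INR k) - ln (x + INR k + 1)) / 1)
      with (- (ln (x + INR k + 1) - ln (x + INR k))) by field.
    rewrite E, Rabs_Ropp, Rabs_right.
    + replace (x + INR k + 1 - (x + INR k)) with 1 by ring. rewrite Rmult_1_r.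
      apply Rinv_le_contravar; lra.
    + apply Rle_ge, Rmult_le_pos; [apply Rlt_le, Rinv_0_lt_compat; lra|lra].
  - apply (is_lim_seq_ext (fun k =>
      / INR (S (S n)) * ndiff (S n) ln (x + INR k)
      + - / INR (S (S n)) * ndiff (S n) ln (x + 1 + INR k))).
    + intros k. change (ndiff (S (S n)) ln (x + INR k)) with
        ((ndiff (S n) ln (x + INR k) - ndiff (S n) ln (x + INR k + 1)) / INR (S (S n))).
      replace (x + 1 + INR k) with (x + INR k + 1) by ring. unfold Rdiv. ring.
    + apply is_lim_seq_0_plus; apply is_lim_seq_0_scal; apply IH; lra.
Qed.

Lemma nrem_ln_lim (n : nat) (x : R) : 0 < x ->
  is_lim_seq (fun k => nrem n ln (/ (x + INR k)) (x + INR k)) 0.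
Proof.
  intros Hx. induction n as [|n IH]; [apply is_lim_seq_inv_shift|].
  apply (is_lim_seq_ext (fun k => / INR (S n) *
    (nrem n ln (/ (x + INR k)) (x + INR k) + ndiff (S n) ln (x + INR k)))).
  - intros k. cbn [nrem]. unfold Rdiv. ring.
  - apply is_lim_seq_0_scal, is_lim_seq_0_plus; [exact IH|apply ndiff_ln_lim, Hx].
Qed.

(** The derivative of [ndiff (S n) ln] is [ipoch (S (S n))], and that of the majorant is at most its
    negative, by the first bound of [ipoch_derive]. Both functions tend to 0 at infinity. *)
Lemma ndiff_ln_bound (n : nat) (x : R) : 0 < x ->
  Rabs (ndiff (S n) ln x) <= ipoch (S n) x / INR (S n).
Proof.
  intros Hx.
  assert (HS : 0 < INR (S n)) by (apply lt_0_INR; lia).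
  apply Rabs_le. split.
  - enough (0 <= / INR (S n) * ipoch (S n) x + 1 * ndiff (S n) ln x) by (unfold Rdiv; lra).
    apply (nonneg_of_decreasing_to_0
      (fun x => / INR (S n) * ipoch (S n) x + 1 * ndiff (S n) ln x)); [| |exact Hx].
    + intros y Hy. destruct (ipoch_derive (S n) y Hy) as [l [Hl [H1 _]]].
      exists (/ INR (S n) * l + 1 * ipoch (S (S n)) y). split.
      * apply @is_derive_plus; apply is_derive_scal; [exact Hl|].
        rewrite <- ndiff_Rinv by exact Hy. apply is_derive_ndiff; [|exact Hy].
        exact is_derive_ln'.
      * apply (Rmult_le_compat_l (/ INR (S n))) in H1;
          [|apply Rlt_le, Rinv_0_lt_compat, HS].
        replace (/ INR (S n) * - (INR (S n) * ipoch (S (S n)) y))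
          with (- ipoch (S (S n)) y) in H1 by (field; lra). lra.
    + intros y Hy. apply is_lim_seq_0_plus; apply is_lim_seq_0_scal;
        [apply ipoch_lim|apply ndiff_ln_lim]; exact Hy.
  - assert (0 <= -1 * ndiff (S n) ln x).
    { apply (nonneg_of_decreasing_to_0 (fun x => -1 * ndiff (S n) ln x)); [| |exact Hx].
      - intros y Hy. exists (-1 * ipoch (S (S n)) y). split.
        + apply is_derive_scal.
          rewrite <- ndiff_Rinv by exact Hy. apply is_derive_ndiff; [|exact Hy].
          exact is_derive_ln'.
        + generalize (ipoch_pos (S (S n)) y Hy); lra.
      - intros y Hy. apply is_lim_seq_0_scal, ndiff_ln_lim, Hy. }
    assert (0 < ipoch (S n) x / INR (S n)) by (apply Rdiv_lt_0_compat; [apply ipoch_pos|]; assumption).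
    lra.
Qed.

(** The remainder decreases to 0 with derivative [- (ipoch (S n) y / y)]; by the second bound of
    [ipoch_derive] the majorant decreases at least as fast. *)
Lemma nrem_ln_bound (n : nat) (x : R) : 0 < x ->
  Rabs (nrem n ln (/ x) x) <= ipoch (S n) x.
Proof.
  intros Hx.
  assert (D : forall y, 0 < y -> is_derive (fun y => nrem n ln (/ y) y) y (- (ipoch (S n) y / y))).
  { intros y Hy. rewrite <- nrem_Rinv by exact Hy.
    apply (is_derive_nrem ln Rinv (fun z => - / (z * z)));
      [exact is_derive_ln'|exact is_derive_Rinv|exact Hy]. }
  rewrite Rabs_right.
  - enough (0 <= 1 * ipoch (S n) x + -1 * nrem n ln (/ x) x) by lra.
    apply (nonneg_of_decreasing_to_0
      (fun x => 1 * ipoch (S n) x + -1 * nrem n ln (/ x) x)); [| |exact Hx].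
    + intros y Hy. destruct (ipoch_derive (S n) y Hy) as [l [Hl [_ H2]]].
      exists (1 * l + -1 * - (ipoch (S n) y / y)). split.
      * apply @is_derive_plus; apply is_derive_scal; [exact Hl|apply D, Hy].
      * assert (l <= - (ipoch (S n) y / y)) by (apply H2; lia). lra.
    + intros y Hy. apply is_lim_seq_0_plus; apply is_lim_seq_0_scal;
        [apply ipoch_lim|apply nrem_ln_lim]; exact Hy.
  - apply Rle_ge, (nonneg_of_decreasing_to_0 (fun x => nrem n ln (/ x) x)); [| |exact Hx].
    + intros y Hy. exists (- (ipoch (S n) y / y)). split; [apply D, Hy|].
      assert (0 < ipoch (S n) y / y) by (apply Rdiv_lt_0_compat; [apply ipoch_pos|]; assumption).
      lra.
    + intros y Hy. apply nrem_ln_lim, Hy.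
Qed.

(** * Differences of powers of the logarithm *)

Fixpoint harmonic (n : nat) : R :=
  match n with
  | O => 0
  | S n => harmonic n + / INR (S n)
  end.

Lemma harmonic_le (m n : nat) : (m <= n)%nat -> harmonic m <= harmonic n.
Proof.
  intros H. induction H as [|n _ IH]; [lra|].
  assert (0 < / INR (S n)) by (apply Rinv_0_lt_compat, lt_0_INR; lia).
  cbn [harmonic]. lra.
Qed.

Lemma harmonic_pos (n : nat) : 0 <= harmonic n.
Proof. apply (harmonic_le 0 n); lia. Qed.

Lemma harmonic_le_ln (n : nat) : harmonic n <= 1 + ln (INR n + 1).
Proof.
  assert (H : forall n, harmonic (S n) <= 1 + ln (INR n + 1)).
  { clear n. intros n. induction n as [|n IH].
    - simpl. rewrite !Rplus_0_l, ln_1. lra.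
    - change (harmonic (S (S n))) with (harmonic (S n) + / INR (S (S n))).
      assert (Hn := pos_INR n).
      destruct (mean_value ln Rinv (INR n + 1) (INR (S n) + 1)) as [c [Hc E]].
      + rewrite S_INR; lra.
      + intros x Hx. apply is_derive_ln'. lra.
      + assert (/ INR (S (S n)) <= / c).
        { apply Rinv_le_contravar; [lra|]. rewrite (S_INR (S n)). lra. }
        replace (INR (S n) + 1 - (INR n + 1)) with 1 in E by (rewrite S_INR; ring).
        lra. }
  destruct n as [|n].
  - simpl. rewrite !Rplus_0_l, ln_1. lra.
  - assert (Hn := pos_INR n). specialize (H n).
    assert (ln (INR n + 1) <= ln (INR (S n) + 1)).
    { apply ln_le; [lra|]. rewrite S_INR. lra. }
    lra.
Qed.

Lemma sum_f_R0_rev (f : nat -> R) (n : nat) :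
  sum_f_R0 (fun k => f (n - k)%nat) n = sum_f_R0 f n.
Proof.
  induction n as [|n IH]; [reflexivity|].
  rewrite decomp_sum by lia. simpl pred.
  rewrite (sum_eq _ (fun i => f (n - i)%nat)) by (intros; f_equal; lia).
  rewrite IH, tech5, Nat.sub_0_r. ring.
Qed.

(** Weights 1/k for Leibniz sums; [a] stands in at k = 0, where the summand is bounded
    differently. *)
Definition inv_or (a : R) (k : nat) : R :=
  match k with O => a | S _ => / INR k end.

Lemma sum_inv_or (a : R) (n : nat) : sum_f_R0 (inv_or a) n = a + harmonic n.
Proof.
  induction n as [|n IH]; [simpl; ring|].
  rewrite tech5, IH. cbn [harmonic inv_or]. ring.
Qed.

Lemma inv_or_pos (a : R) (k : nat) : 0 <= a -> 0 <= inv_or a k.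
Proof.
  intros Ha. destruct k; [exact Ha|]. apply Rlt_le, Rinv_0_lt_compat, lt_0_INR. lia.
Qed.

(** The hypothesis has the shape produced by 1/(i l) = (1/i + 1/l)/(i + l), so a Leibniz sum costs
    two harmonic sums and the two end terms. *)
Lemma sum_bound (t : nat -> R) (a q : R) (n : nat) :
  (forall k, (k <= n)%nat -> Rabs (t k) <= q * (inv_or a k + inv_or 1 (n - k))) ->
  Rabs (sum_f_R0 t n) <= q * (a + 1 + 2 * harmonic n).
Proof.
  intros H. eapply Rle_trans; [apply Rsum_abs|].
  eapply Rle_trans; [apply sum_Rle; exact H|].

  rewrite (sum_eq _ (fun k => (inv_or a k + inv_or 1 (n - k)) * q)) by (intros; ring).
  rewrite <- scal_sum, sum_plus, (sum_f_R0_rev (inv_or 1)), !sum_inv_or.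
  apply Req_le. ring.
Qed.

Definition ln_pow_deriv (j : nat) (x : R) : R :=
  match j with O => 0 | S i => INR j * ln x ^ i / x end.

(** The product rule, arranged as [vf * g x + f x * vg] to match [nrem_mul]. *)
Lemma ln_pow_deriv_S (j : nat) (x : R) :
  ln_pow_deriv (S j) x = / x * ln x ^ j + ln x * ln_pow_deriv j x.
Proof.
  destruct j as [|j]; cbn [ln_pow_deriv]; [simpl; unfold Rdiv; ring|].
  rewrite (S_INR (S j)). simpl pow. unfold Rdiv. ring.
Qed.

Lemma ndiff_const (n : nat) (c : R) : forall x, ndiff (S n) (fun _ => c) x = 0.
Proof.
  induction n as [|n IH]; intros x.
  - simpl. field.
  - change (ndiff (S (S n)) (fun _ => c) x) with
      ((ndiff (S n) (fun _ => c) x - ndiff (S n) (fun _ => c) (x + 1)) / INR (S (S n))).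
    rewrite !IH. unfold Rdiv. ring.
Qed.

Lemma nrem_const (n : nat) (c x : R) : nrem n (fun _ => c) 0 x = 0.
Proof.
  induction n as [|n IH]; [reflexivity|].
  cbn [nrem]. rewrite IH, ndiff_const. unfold Rdiv. ring.
Qed.

Section LogPowers.

(** All nodes lie among u, ..., u+N, and [L] dominates both the logarithms there and the harmonic
    sums. A further factor [ln] then multiplies a bound by at most L + 2 L, hence the powers of 3
    L. *)
Variables (u L : R) (N : nat).
Hypothesis Hu : 0 < u.
Hypothesis HL : 1 + / u + 2 * harmonic N <= L.
Hypothesis Hln : forall k, (k <= N)%nat -> Rabs (ln (u + INR k)) <= L.

Let L1 : 1 <= L.
Proof.
  assert (0 < / u) by (apply Rinv_0_lt_compat, Hu). generalize (harmonic_pos N); lra.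
Qed.

Let pow_step (j : nat) (a : R) : a <= 2 * L -> (3 * L) ^ j * (L + a) <= (3 * L) ^ S j.
Proof.
  intros Ha. simpl. rewrite (Rmult_comm (3 * L)).
  apply Rmult_le_compat_l; [apply pow_le|]; lra.
Qed.

Let ln_pow_le (j k : nat) : (k <= N)%nat -> Rabs (ln (u + INR k) ^ j) <= (3 * L) ^ j.
Proof.
  intros Hk. rewrite <- RPow_abs. apply pow_incr. split; [apply Rabs_pos|].
  specialize (Hln k Hk). lra.
Qed.

(** Induction on j through ln * ln^j. The two end summands contain an undifferenced factor, bounded
    by [L] or by [ln_pow_le]; in between, [ipoch_add] recombines the majorants and 1/(i l) splits
    into partial fractions. *)
Lemma ndiff_ln_pow_bound (j : nat) : forall k n, (k + S n <= N)%nat ->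
  Rabs (ndiff (S n) (fun x => ln x ^ j) (u + INR k))
  <= (3 * L) ^ j * (ipoch (S n) (u + INR k) / INR (S n)).
Proof.
  induction j as [|j IH]; intros k n Hk.
  { change (fun x => ln x ^ 0) with (fun _ : R => 1).
    rewrite ndiff_const, Rabs_R0. simpl pow. rewrite Rmult_1_l.
    apply Rlt_le, Rdiv_lt_0_compat; [apply ipoch_pos|apply lt_0_INR; lia].
    generalize (pos_INR k); lra. }
  assert (Hk0 := pos_INR k).
  assert (HS : 0 < INR (S n)) by (apply lt_0_INR; lia).
  change (fun x => ln x ^ S j) with (fun x => ln x * ln x ^ j).
  rewrite ndiff_mul.
  set (M := (3 * L) ^ j) in *.
  assert (HM : 0 <= M) by (apply pow_le; lra).
  set (x := u + INR k) in *.
  set (q := M * (ipoch (S n) x / INR (S n))).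
  assert (Hq : 0 <= ipoch (S n) x / INR (S n)).
  { apply Rlt_le, Rdiv_lt_0_compat; [apply ipoch_pos; unfold x; lra|exact HS]. }
  assert (Hq' : 0 <= q) by (apply Rmult_le_pos; assumption).
  apply Rle_trans with (q * (L + 1 + 2 * harmonic (S n))).
  - apply sum_bound. intros i Hi. rewrite Rabs_mult.
    destruct i as [|i].
    { rewrite Nat.sub_0_r. cbn [ndiff].
      replace (x + INR 0) with x by (simpl; ring).
      apply Rle_trans with (L * q).
      - apply Rmult_le_compat; try apply Rabs_pos; [apply Hln; lia|apply IH; exact Hk].
      - rewrite Rmult_comm. apply Rmult_le_compat_l; [exact Hq'|].
        cbn [inv_or]. generalize (Rlt_le _ _ (Rinv_0_lt_compat _ HS)); lra. }
    assert (Hb := ndiff_ln_bound i x).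
    destruct (Nat.eq_dec (S i) (S n)) as [E|E].
    { rewrite <- E, Nat.sub_diag. cbn [ndiff].
      apply Rle_trans with (q * 1).
      - rewrite Rmult_1_r. unfold q. rewrite Rmult_comm, <- E.
        apply Rmult_le_compat; try apply Rabs_pos.
        + unfold x. rewrite Rplus_assoc, <- plus_INR. apply ln_pow_le. lia.
        + apply Hb. unfold x; lra.
      - apply Rmult_le_compat_l; [exact Hq'|].
        simpl inv_or at 2. generalize (inv_or_pos L (S i)); lra. }
    assert (Hd : exists l, (S n - S i = S l)%nat) by (exists (n - S i)%nat; lia).
    destruct Hd as [l Hl]. rewrite Hl. cbn [inv_or].
    assert (0 < INR (S i)) by (apply lt_0_INR; lia).
    assert (0 < INR (S l)) by (apply lt_0_INR; lia).
    assert (Hx : x + INR (S i) = u + INR (k + S i)) by (unfold x; rewrite plus_INR; ring).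
    apply Rle_trans with ((ipoch (S i) x / INR (S i))
        * (M * (ipoch (S l) (x + INR (S i)) / INR (S l)))).
    + apply Rmult_le_compat; try apply Rabs_pos; [apply Hb; unfold x; lra|].
      rewrite Hx. apply IH. lia.
    + apply Req_le. unfold q.
      replace (S n) with (S i + S l)%nat by lia.
      rewrite ipoch_add, plus_INR. field. lra.
  - unfold q. rewrite (Rmult_comm M), (Rmult_assoc _ M).
    rewrite (Rmult_comm _ (ipoch (S n) x / INR (S n))).
    apply Rmult_le_compat_l; [exact Hq|].
    rewrite Rplus_assoc. apply pow_step.
    assert (harmonic (S n) <= harmonic N) by (apply harmonic_le; lia).
    assert (0 < / u) by (apply Rinv_0_lt_compat, Hu). lra.
Qed.

(** Same induction with the node u doubled. The leading Leibniz term costs [L]; the sum costs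
    [/ u + 1 + 2 * harmonic (S n)], where [/ u] comes from the value of ln' at u. *)
Lemma nrem_ln_pow_bound (j : nat) : forall n, (S n <= N)%nat ->
  Rabs (nrem (S n) (fun x => ln x ^ j) (ln_pow_deriv j u) u)
  <= (3 * L) ^ j * (ipoch (S n) u / INR (S n)).
Proof.
  induction j as [|j IH]; intros n Hn.
  { change (fun x => ln x ^ 0) with (fun _ : R => 1).
    cbn [ln_pow_deriv]. rewrite nrem_const, Rabs_R0. simpl pow. rewrite Rmult_1_l.
    apply Rlt_le, Rdiv_lt_0_compat; [apply ipoch_pos, Hu|apply lt_0_INR; lia]. }
  assert (HS : 0 < INR (S n)) by (apply lt_0_INR; lia).
  change (fun x => ln x ^ S j) with (fun x => ln x * ln x ^ j).
  rewrite ln_pow_deriv_S, (nrem_mul ln (fun x => ln x ^ j)).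
  set (M := (3 * L) ^ j) in *.
  assert (HM : 0 <= M) by (apply pow_le; lra).
  set (q := M * (ipoch (S n) u / INR (S n))).
  assert (Hp := ipoch_pos (S n) u Hu).
  assert (Hq : 0 <= ipoch (S n) u / INR (S n)) by (apply Rlt_le, Rdiv_lt_0_compat; assumption).
  assert (Hq' : 0 <= q) by (apply Rmult_le_pos; assumption).
  assert (Hiu : 0 < / u) by (apply Rinv_0_lt_compat, Hu).
  apply Rle_trans with (q * L + q * (/ u + 1 + 2 * harmonic (S n))).
  - eapply Rle_trans; [apply Rabs_triang|]. apply Rplus_le_compat.
    { rewrite Rabs_mult, Rmult_comm. apply Rmult_le_compat; try apply Rabs_pos; [apply IH, Hn|].
      replace u with (u + INR 0) by (simpl; ring). apply Hln. lia. }
    apply sum_bound. intros i Hi. rewrite Rabs_mult.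
    assert (Hb := nrem_ln_bound i u Hu).
    assert (Hi0 := pos_INR i).
    destruct (Nat.eq_dec i (S n)) as [E|E].
    { rewrite <- E, Nat.sub_diag. cbn [ndiff].
      apply Rle_trans with (q * 1).
      - rewrite Rmult_1_r. unfold q. rewrite Rmult_comm.
        apply Rmult_le_compat; try apply Rabs_pos.
        + apply ln_pow_le. lia.
        + eapply Rle_trans; [exact Hb|]. rewrite E. cbn [ipoch].
          apply Rmult_le_compat_l; [apply Rlt_le, Hp|].
          apply Rinv_le_contravar; [exact HS|lra].
      - apply Rmult_le_compat_l; [exact Hq'|].
        simpl inv_or at 2. generalize (inv_or_pos (/ u) i); lra. }
    assert (Hd : exists l, (S n - i = S l)%nat) by (exists (n - i)%nat; lia).
    destruct Hd as [l Hl]. rewrite Hl.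
    assert (Hl0 : 0 < INR (S l)) by (apply lt_0_INR; lia).
    apply Rle_trans with (ipoch (S i) u
        * (M * (ipoch (S l) (u + INR i) / INR (S l)))).
    { apply Rmult_le_compat; try apply Rabs_pos; [exact Hb|].
      apply ndiff_ln_pow_bound. lia. }
    (* With l here for [S l]: 1/((u+i) l) = (1/(u+i) + 1/l)/(u+i+l), after which u is dropped from
       the last denominator. *)
    apply Rle_trans with (M * ipoch (S n) u * (/ INR (S n) * (/ (u + INR i) + / INR (S l)))).
    + replace (S n) with (i + S l)%nat by lia. rewrite ipoch_add.
      change (ipoch (S i) u) with (ipoch i u * / (u + INR i)).
      assert (0 < ipoch i u) by (apply ipoch_pos, Hu).
      assert (0 < ipoch (S l) (u + INR i)) by (apply ipoch_pos; lra).
      apply Rle_trans with (M * (ipoch i u * ipoch (S l) (u + INR i)) *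
        (/ (u + INR (i + S l)) * (/ (u + INR i) + / INR (S l)))).
      * apply Req_le. rewrite plus_INR. field. lra.
      * apply Rmult_le_compat_l.
        { apply Rmult_le_pos; [exact HM|]. apply Rlt_le, Rmult_lt_0_compat; assumption. }
        apply Rmult_le_compat_r.
        { apply Rlt_le, Rplus_lt_0_compat; apply Rinv_0_lt_compat; lra. }
        apply Rinv_le_contravar; [|lra]. rewrite plus_INR. lra.
    + unfold q, Rdiv. rewrite <- !Rmult_assoc, !(Rmult_assoc M), !Rmult_assoc.
      apply Rmult_le_compat_l; [exact HM|]. apply Rmult_le_compat_l; [lra|].
      apply Rmult_le_compat_l; [apply Rlt_le, Rinv_0_lt_compat, HS|].
      apply Rplus_le_compat; [|cbn [inv_or]; lra].
      destruct i as [|i]; cbn [inv_or].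
      * simpl. rewrite Rplus_0_r. lra.
      * apply Rinv_le_contravar; [apply lt_0_INR; lia|lra].
  - rewrite <- Rmult_plus_distr_l. unfold q. rewrite (Rmult_comm M), (Rmult_assoc _ M).
    rewrite (Rmult_comm _ (ipoch (S n) u / INR (S n))).
    apply Rmult_le_compat_l; [exact Hq|].
    apply pow_step.
    assert (harmonic (S n) <= harmonic N) by (apply harmonic_le; lia). lra.
Qed.

End LogPowers.

(** * The series over [n] as an Euler-Maclaurin limit *)

Lemma exp_le_compat (x y : R) : x <= y -> exp x <= exp y.
Proof.
  intros [H|H]; [apply Rlt_le, exp_increasing, H|rewrite H; apply Rle_refl].
Qed.

Lemma Rpower_pos (t a : R) : 0 < Rpower t a.
Proof. apply exp_pos. Qed.

Lemma ln_le_Rpower (t b : R) : 0 < b -> ln t <= / b * Rpower t b.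
Proof.
  intros Hb. assert (H := exp_ineq1_le (b * ln t)). unfold Rpower.
  apply (Rmult_le_reg_l b); [exact Hb|]. rewrite <- Rmult_assoc, Rinv_r by lra. lra.
Qed.

Lemma Rpower_ge_1 (t b : R) : 1 <= t -> 0 <= b -> 1 <= Rpower t b.
Proof.
  intros Ht Hb. rewrite <- (Rpower_O t) by lra. apply Rle_Rpower; lra.
Qed.

(** Half of the exponent pays for one logarithm, the other half for the remaining power. *)
Lemma ln_pow_le_Rpower (C : R) (j : nat) : 0 <= C -> forall a, 0 < a ->
  exists K, 0 < K /\ forall t, 1 <= t -> (3 * (C + 2 * ln t)) ^ j <= K * Rpower t a.
Proof.
  intros HC. induction j as [|j IH]; intros a Ha.
  - exists 1. split; [lra|]. intros t Ht. simpl. rewrite Rmult_1_l. apply Rpower_ge_1; lra.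
  - destruct (IH (a / 2)) as [K [HK H]]; [lra|].
    assert (Hi : 0 < / (a / 2)) by (apply Rinv_0_lt_compat; lra).
    exists (3 * (C + 2 * / (a / 2)) * K). split; [apply Rmult_lt_0_compat; lra|].
    intros t Ht.
    replace a with (a / 2 + a / 2) at 2 by field. rewrite Rpower_plus.
    assert (H1 := Rpower_ge_1 t (a / 2) Ht ltac:(lra)).
    assert (H2 := ln_le_Rpower t (a / 2) ltac:(lra)).
    assert (H3 : 0 <= ln t) by (rewrite <- ln_1; apply ln_le; lra).
    simpl pow.
    apply Rle_trans with ((3 * (C + 2 * / (a / 2)) * Rpower t (a / 2)) * (K * Rpower t (a / 2)));
      [|apply Req_le; ring].
    apply Rmult_le_compat; [lra|apply pow_le; lra| |apply H, Ht].
    assert (C * 1 <= C * Rpower t (a / 2)) by (apply Rmult_le_compat_l; lra). lra.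
Qed.

Lemma ln_interval_bound (u x : R) (N : nat) : 0 < u -> u <= x <= u + INR N ->
  Rabs (ln x) <= Rabs (ln u) + ln (1 + u) + ln (INR N + 1).
Proof.
  intros Hu Hx. assert (HN := pos_INR N).
  assert (0 <= ln (1 + u)) by (rewrite <- ln_1; apply ln_le; lra).
  assert (0 <= ln (INR N + 1)) by (rewrite <- ln_1; apply ln_le; lra).
  assert (ln u <= ln x) by (apply ln_le; lra).
  assert (ln x <= ln (1 + u) + ln (INR N + 1)).
  { rewrite <- ln_mult by lra. apply ln_le; [lra|].
    assert (0 <= u * INR N) by (apply Rmult_le_pos; lra). lra. }
  assert (Ha := Rle_abs (- ln u)). rewrite Rabs_Ropp in Ha.
  assert (Hb := Rabs_pos (ln u)).
  apply Rabs_le. lra.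
Qed.

Lemma bernoulli_Rpower (y d : R) : 0 <= y -> 0 <= d <= 1 -> Rpower (1 + y) d <= 1 + d * y.
Proof.
  intros Hy Hd.
  assert (H0 : 0 <= d * y) by (apply Rmult_le_pos; lra).
  rewrite <- (exp_ln (1 + d * y)) by lra. unfold Rpower.
  apply exp_le_compat.
  destruct (mean_value (fun z => ln (1 + d * z) - d * ln (1 + z))
    (fun z => d * / (1 + d * z) - d * / (1 + z)) 0 y Hy) as [c [Hc E]].
  - intros x Hx. assert (0 <= d * x) by (apply Rmult_le_pos; lra).
    auto_derive; [lra|field; lra].
  - rewrite Rmult_0_r, Rplus_0_r, ln_1, Rmult_0_r in E.
    assert (0 <= d * c <= 1 * c).
    { split; [apply Rmult_le_pos; lra|]. apply Rmult_le_compat_r; lra. }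
    assert (/ (1 + c) <= / (1 + d * c)) by (apply Rinv_le_contravar; lra).
    assert (0 <= (d * / (1 + d * c) - d * / (1 + c)) * (y - 0)); [|lra].
    apply Rmult_le_pos; [|lra].
    assert (d * / (1 + c) <= d * / (1 + d * c)) by (apply Rmult_le_compat_l; lra). lra.
Qed.

(** A step from n to n+1 multiplies the left side by 1/(1 + v/(n+1)), while Bernoulli's inequality
    gives (1 + 1/(n+1))^d <= 1 + d/(n+1) <= 1 + v/(n+1). *)
Lemma fact_ipoch_bound (v d : R) (n : nat) : 0 < v -> 0 <= d <= 1 -> d <= v ->
  INR (fact n) * ipoch (S n) v <= / v * Rpower (INR n + 1) (- d).
Proof.
  intros Hv Hd Hdv. induction n as [|n IH].
  { simpl. rewrite Rplus_0_l, Rplus_0_r.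
    rewrite Rpower_Ropp. unfold Rpower. rewrite ln_1, Rmult_0_r, exp_0. apply Req_le. field. lra. }
  assert (Hn := pos_INR n).
  assert (Hv' : 0 < / v) by (apply Rinv_0_lt_compat, Hv).
  rewrite fact_simpl, mult_INR. rewrite S_INR at 1.
  change (ipoch (S (S n)) v) with (ipoch (S n) v * / (v + INR (S n))).
  rewrite !S_INR.
  apply Rle_trans with ((/ v * Rpower (INR n + 1) (- d)) * ((INR n + 1) / (v + (INR n + 1)))).
  { replace ((INR n + 1) * INR (fact n) * (ipoch (S n) v * / (v + (INR n + 1))))
      with (INR (fact n) * ipoch (S n) v * ((INR n + 1) / (v + (INR n + 1))))
      by (unfold Rdiv; ring).
    apply Rmult_le_compat_r; [|exact IH].
    apply Rlt_le, Rdiv_lt_0_compat; lra. }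
  rewrite Rmult_assoc. apply Rmult_le_compat_l; [lra|].
  assert (B := bernoulli_Rpower (/ (INR n + 1)) d
    ltac:(apply Rlt_le, Rinv_0_lt_compat; lra) Hd).
  replace (INR n + 1 + 1) with ((INR n + 1) * (1 + / (INR n + 1))) by (field; lra).
  assert (0 < / (INR n + 1)) by (apply Rinv_0_lt_compat; lra).
  rewrite <- Rpower_mult_distr by lra.
  apply Rmult_le_compat_l; [apply Rlt_le, Rpower_pos|].
  rewrite Rpower_Ropp.
  replace ((INR n + 1) / (v + (INR n + 1))) with (/ (1 + v * / (INR n + 1))) by (field; lra).
  apply Rinv_le_contravar; [apply Rpower_pos|].
  assert (d * / (INR n + 1) <= v * / (INR n + 1)) by (apply Rmult_le_compat_r; lra). lra.
Qed.

(* The exponent is uniform in the shift [k]; this gives both the convergence of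
   the series over [n] and its limit as [k] tends to infinity. *)
Lemma ln_pow_growth (u : R) (j : nat) : 0 < u ->
  exists K a, 0 < K /\ 0 < a /\
   (forall k n, Rabs (INR (fact (S n)) * ndiff (S n) (fun x => ln x ^ j) (u + INR k))
      <= K * (Rpower (INR k + 1) (- a) * Rpower (INR n + 1) (- a))) /\
   (forall n, Rabs (INR (fact (S n)) * nrem (S n) (fun x => ln x ^ j) (ln_pow_deriv j u) u)
      <= K * Rpower (INR n + 1) (- a)).
Proof.
  intros Hu.
  (* The 3 is the 1 in the condition on [L] plus twice the 1 of [harmonic_le_ln]. *)
  set (C := 3 + / u + Rabs (ln u) + ln (1 + u)).
  assert (Hiu : 0 < / u) by (apply Rinv_0_lt_compat, Hu).
  assert (H0 := Rabs_pos (ln u)).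
  assert (H1 : 0 <= ln (1 + u)) by (rewrite <- ln_1; apply ln_le; lra).
  assert (Hlog : forall N, 0 <= ln (INR N + 1)).
  { intros N. assert (HN := pos_INR N). rewrite <- ln_1; apply ln_le; lra. }
  set (L := fun N : nat => C + 2 * ln (INR N + 1)).
  assert (HL : forall N, 1 + / u + 2 * harmonic N <= L N).
  { intros N. generalize (harmonic_le_ln N). unfold L, C. lra. }
  assert (Hln : forall N k, (k <= N)%nat -> Rabs (ln (u + INR k)) <= L N).
  { intros N k Hk. apply le_INR in Hk. assert (Hk0 := pos_INR k).
    generalize (ln_interval_bound u (u + INR k) N Hu ltac:(lra)) (Hlog N). unfold L, C. lra. }
  (* Bernoulli's inequality needs d <= 1, and d <= u gives d (k+1) <= u + k. Half of d will absorb
     the power of the logarithm. *)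
  set (d := Rmin u 1).
  assert (Hd : 0 < d <= 1).
  { unfold d. split; [apply Rmin_glb_lt; lra|apply Rmin_r]. }
  assert (Hdu : d <= u) by apply Rmin_l.
  destruct (ln_pow_le_Rpower C j ltac:(unfold C; lra) (d / 2) ltac:(lra)) as [K [HK HKt]].
  set (K' := K * Rpower 2 (d / 2) * / d).
  assert (Hid : 0 < / d) by (apply Rinv_0_lt_compat; lra).
  assert (H2d := Rpower_pos 2 (d / 2)).
  exists K', (d / 2).
  split; [unfold K'; repeat apply Rmult_lt_0_compat; lra|]. split; [lra|].
  assert (Main : forall k n q,
    Rabs q <= (3 * L (k + S n)%nat) ^ j * (ipoch (S n) (u + INR k) / INR (S n)) ->
    Rabs (INR (fact (S n)) * q)
      <= K' * (Rpower (INR k + 1) (- (d / 2)) * Rpower (INR n + 1) (- (d / 2)))).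
  { intros k n q Hq. assert (Hk := pos_INR k). assert (Hn := pos_INR n).
    rewrite Rabs_mult, (Rabs_right (INR (fact (S n)))) by (apply Rle_ge, pos_INR).
    apply Rle_trans with ((3 * L (k + S n)%nat) ^ j * (INR (fact n) * ipoch (S n) (u + INR k))).
    { apply (Rmult_le_compat_l (INR (fact (S n)))) in Hq; [|apply pos_INR].
      eapply Rle_trans; [exact Hq|]. apply Req_le.
      rewrite fact_simpl, mult_INR. field. apply not_0_INR; lia. }
    (* The inequality k + n + 2 <= 2 (k+1)(n+1) separates the two indices, and 1/(u+k) <= 1/(d
       (k+1)) supplies the decay in k. *)
    apply Rle_trans with (K * Rpower (2 * ((INR k + 1) * (INR n + 1))) (d / 2)
      * (/ d * Rpower (INR k + 1) (- (1)) * Rpower (INR n + 1) (- d))).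
    { apply Rmult_le_compat.
      - apply pow_le. generalize (HL (k + S n)%nat) (harmonic_pos (k + S n)). lra.
      - apply Rmult_le_pos; [apply pos_INR|apply Rlt_le, ipoch_pos; lra].
      - eapply Rle_trans; [apply HKt; generalize (pos_INR (k + S n)); lra|].
        apply Rmult_le_compat_l; [lra|]. apply Rle_Rpower_l; [lra|].
        rewrite plus_INR, S_INR.
        assert (0 <= INR k * INR n) by (apply Rmult_le_pos; assumption). lra.
      - eapply Rle_trans; [apply (fact_ipoch_bound _ d); lra|].
        apply Rmult_le_compat_r; [apply Rlt_le, Rpower_pos|].
        rewrite Rpower_Ropp, Rpower_1, <- Rinv_mult by lra.
        apply Rinv_le_contravar; [apply Rmult_lt_0_compat; lra|].
        assert (d * INR k <= 1 * INR k) by (apply Rmult_le_compat_r; lra). lra. }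
    rewrite <- Rpower_mult_distr by (try apply Rmult_lt_0_compat; lra).
    rewrite <- Rpower_mult_distr by lra.
    apply Rle_trans with (K' * (Rpower (INR k + 1) (d / 2 + - (1)) * Rpower (INR n + 1) (d / 2 + - d))).
    { apply Req_le. rewrite !Rpower_plus. unfold K'. ring. }
    replace (d / 2 + - d) with (- (d / 2)) by field.
    apply Rmult_le_compat_l; [unfold K'; apply Rlt_le; repeat apply Rmult_lt_0_compat; lra|].
    apply Rmult_le_compat_r; [apply Rlt_le, Rpower_pos|].
    apply Rle_Rpower; lra. }
  split.
  - intros k n. apply Main.
    apply (ndiff_ln_pow_bound u (L (k + S n)%nat) (k + S n)); auto.
  - intros n. specialize (Main 0%nat n (nrem (S n) (fun x => ln x ^ j) (ln_pow_deriv j u) u)).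
    eapply Rle_trans; [apply Main|].
    + replace (u + INR 0) with u by (simpl; ring).
      apply (nrem_ln_pow_bound u (L (0 + S n)%nat) (0 + S n)); auto.
    + apply Req_le. simpl (INR 0). rewrite Rplus_0_l. unfold Rpower at 1.
      rewrite ln_1, Rmult_0_r, exp_0. ring.
Qed.

Lemma Rpower_neg_lim (a : R) : 0 < a -> is_lim_seq (fun n => Rpower (INR n + 1) (- a)) 0.
Proof.
  intros Ha.
  apply (is_lim_seq_ext (fun n => / Rpower (INR n + 1) a)); [intros; symmetry; apply Rpower_Ropp|].
  replace (Finite 0) with (Rbar_inv p_infty) by reflexivity.
  apply is_lim_seq_inv; [|discriminate].
  apply (is_lim_seq_le_p_loc (fun n => a * ln (INR n + 1))).
  - exists 0%nat. intros n _.
    assert (H := ln_le_Rpower (INR n + 1) a Ha).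
    apply (Rmult_le_compat_l a) in H; [|lra].
    rewrite <- Rmult_assoc, Rinv_r, Rmult_1_l in H by lra. exact H.
  - apply is_lim_seq_spec. intros M.
    assert (Hl : is_lim_seq (fun n => INR n + 1) p_infty).
    { eapply is_lim_seq_plus; [apply is_lim_seq_INR|apply is_lim_seq_const|reflexivity]. }
    apply is_lim_seq_spec in Hl. destruct (Hl (exp (M / a))) as [N HN].
    exists N. intros n Hn. specialize (HN n Hn).
    apply ln_increasing in HN; [|apply exp_pos]. rewrite ln_exp in HN.
    apply (Rmult_lt_compat_l a) in HN; [|exact Ha].
    replace (a * (M / a)) with M in HN by (field; lra). exact HN.
Qed.

Lemma ex_series_dominated (a b : nat -> R) :
  (forall n, Rabs (a n) <= b n) -> ex_series b -> ex_series a.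
Proof. exact (@ex_series_le R_AbsRing R_CompleteNormedModule a b). Qed.

Lemma ex_series_Rmult (c : R) (a : nat -> R) :
  ex_series a -> ex_series (fun n => c * a n).
Proof. exact (@ex_series_scal R_AbsRing R_NormedModule c a). Qed.

Lemma is_series_telescope (e : nat -> R) (l : R) :
  is_lim_seq e l -> is_series (fun k => e (S k) - e k) (l - e 0%nat).
Proof.
  intros H.
  assert (E : forall n, sum_n (fun k => e (S k) - e k) n = e (S n) - e 0%nat).
  { intros n. induction n as [|n IH]; [apply sum_O|].
    rewrite sum_Sn, IH. unfold plus; simpl. ring. }
  change (is_lim_seq (sum_n (fun k => e (S k) - e k)) (l - e 0%nat)).
  apply (is_lim_seq_ext (fun n => e (S n) - e 0%nat)); [intros; symmetry; apply E|].
  apply is_lim_seq_minus'; [|apply is_lim_seq_const].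
  apply (is_lim_seq_incr_1 e), H.
Qed.

(** Telescoping instead of an integral test: (n+2)^(-1-a) is at most the drop of x^(-a)/a from n+1
    to n+2, by the mean value theorem. *)
Lemma ex_series_Rpower (a : R) : 0 < a ->
  ex_series (fun n => Rpower (INR n + 1) (- (1 + a))).
Proof.
  intros Ha. apply ex_series_incr_1.
  apply (ex_series_dominated _ (fun n => - / a * (Rpower (INR (S n) + 1) (- a) - Rpower (INR n + 1) (- a)))).
  - intros n. assert (Hn := pos_INR n).
    rewrite Rabs_right by apply Rle_ge, Rlt_le, Rpower_pos.
    destruct (mean_value (fun x => Rpower x (- a)) (fun x => - a * Rpower x (- (1 + a)))
      (INR n + 1) (INR (S n) + 1)) as [c [Hc E]].
    + rewrite S_INR; lra.
    + intros x Hx.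
      replace (- a * Rpower x (- (1 + a))) with (- a * Rpower x (- a - 1)) by (f_equal; f_equal; ring).
      apply is_derive_Reals, derivable_pt_lim_power. lra.
    + cbv beta in E. rewrite E.
      replace (INR (S n) + 1 - (INR n + 1)) with 1 by (rewrite S_INR; ring).
      apply Rle_trans with (Rpower c (- (1 + a))); [|apply Req_le; field; lra].
      rewrite !(Rpower_Ropp _ (1 + a)). apply Rinv_le_contravar; [apply Rpower_pos|].
      apply Rle_Rpower_l; lra.
  - apply (ex_series_Rmult (- / a)).
    eexists. apply (is_series_telescope (fun n => Rpower (INR n + 1) (- a)) 0), Rpower_neg_lim, Ha.
Qed.

(** * The series S (ln^j) *)

Definition hasse_term (j : nat) (x : R) (n : nat) : R :=
  INR (fact n) * ndiff n (fun x => ln x ^ j) x / (INR n + 1).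

(** The index starts at [S n] because the zeroth term is ln^j itself, which does not decay in k. *)
Lemma hasse_term_bound (u : R) (j : nat) : 0 < u ->
  exists K a, 0 < K /\ 0 < a /\ forall k n,
    Rabs (hasse_term j (u + INR k) (S n))
      <= K * Rpower (INR k + 1) (- a) * Rpower (INR n + 1) (- (1 + a)).
Proof.
  intros Hu. destruct (ln_pow_growth u j Hu) as [K [a [HK [Ha [H _]]]]].
  exists K, a. split; [exact HK|]. split; [exact Ha|].
  intros k n. assert (Hn := pos_INR n). unfold hasse_term, Rdiv.
  rewrite Rabs_mult, (Rabs_right (/ _)).
  2:{ apply Rle_ge, Rlt_le, Rinv_0_lt_compat. generalize (pos_INR (S n)); lra. }
  apply Rle_trans with (K * (Rpower (INR k + 1) (- a) * Rpower (INR n + 1) (- a))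
    * Rpower (INR n + 1) (- (1))).
  - apply Rmult_le_compat; [apply Rabs_pos| |apply H|].
    + apply Rlt_le, Rinv_0_lt_compat. generalize (pos_INR (S n)); lra.
    + rewrite Rpower_Ropp, Rpower_1 by lra. apply Rinv_le_contravar; [lra|].
      rewrite S_INR; lra.
  - apply Req_le. replace (- (1 + a)) with (- a + - (1)) by ring. rewrite Rpower_plus. ring.
Qed.

Lemma ex_series_hasse (u : R) (j : nat) : 0 < u -> ex_series (hasse_term j u).
Proof.
  intros Hu. destruct (hasse_term_bound u j Hu) as [K [a [HK [Ha H]]]].
  apply ex_series_incr_1.
  apply (ex_series_dominated _ (fun n => K * Rpower (INR n + 1) (- (1 + a)))).
  - intros n. specialize (H 0%nat n).
    replace (u + INR 0) with u in H by (simpl; ring).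
    replace (Rpower (INR 0 + 1) (- a)) with 1 in H; [rewrite Rmult_1_r in H; exact H|].
    simpl (INR 0). rewrite Rplus_0_l. unfold Rpower. rewrite ln_1, Rmult_0_r, exp_0. reflexivity.
  - apply (ex_series_Rmult K), ex_series_Rpower, Ha.
Qed.

(** Since (1 - E)^n - (1 - E)^n E = (1 - E)^(n+1), the difference of the N-th partial sums is the
    Newton series of - f' cut after order N+1. Its defect is (N+1)! times [nrem (S N)], which tends
    to 0. *)
Lemma hasse_step (x : R) (j : nat) : 0 < x ->
  Series (hasse_term j x) - Series (hasse_term j (x + 1)) = - ln_pow_deriv j x.
Proof.
  intros Hx.
  assert (E : forall N, sum_n (hasse_term j x) N - sum_n (hasse_term j (x + 1)) N
     = INR (fact (S N)) * nrem (S N) (fun y => ln y ^ j) (ln_pow_deriv j x) x - ln_pow_deriv j x).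
  { intros N. induction N as [|N IH].
    - rewrite !sum_O. unfold hasse_term. simpl. field.
    - rewrite !sum_Sn. unfold plus; simpl (Hierarchy.plus _ _).
      set (f := fun y => ln y ^ j) in *. set (v := ln_pow_deriv j x) in *.
      assert (HN := pos_INR (S N)).
      transitivity (INR (fact (S N)) * nrem (S N) f v x - v
        + INR (fact (S N)) * ndiff (S (S N)) f x).
      + rewrite <- IH. change (ndiff (S (S N)) f x) with
          ((ndiff (S N) f x - ndiff (S N) f (x + 1)) / INR (S (S N))).
        unfold hasse_term, f, plus; simpl (Hierarchy.plus _ _).
        change (AbelianMonoid.plus _ (AbelianMonoid.class R_AbelianMonoid)) with Rplus.
        rewrite (S_INR (S N)). field. lra.
      + change (nrem (S (S N)) f v x) with ((nrem (S N) f v x + ndiff (S (S N)) f x) / INR (S (S N))).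
        rewrite (fact_simpl (S N)), mult_INR. field. apply not_0_INR. lia. }
  destruct (ln_pow_growth x j Hx) as [K [a [HK [Ha [_ H]]]]].
  assert (L1 : is_lim_seq (fun N => sum_n (hasse_term j x) N - sum_n (hasse_term j (x + 1)) N)
     (Series (hasse_term j x) - Series (hasse_term j (x + 1)))).
  { apply is_lim_seq_minus'; apply Series_correct, ex_series_hasse; lra. }
  assert (L2 : is_lim_seq (fun N => sum_n (hasse_term j x) N - sum_n (hasse_term j (x + 1)) N)
     (0 - ln_pow_deriv j x)).
  { eapply is_lim_seq_ext; [intros; symmetry; apply E|].
    apply is_lim_seq_minus'; [|apply is_lim_seq_const].
    eapply is_lim_seq_0_bound; [exact H|]. apply is_lim_seq_0_scal, Rpower_neg_lim, Ha. }
  apply is_lim_seq_unique in L1. apply is_lim_seq_unique in L2.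
  rewrite L1 in L2. injection L2. lra.
Qed.

(** The zeroth term cancels ln^j; the others sum to at most a constant times (k+1)^(-a). *)
Lemma hasse_shift_lim (u : R) (j : nat) : 0 < u ->
  is_lim_seq (fun k => ln (u + INR k) ^ j - Series (hasse_term j (u + INR k))) 0.
Proof.
  intros Hu. destruct (hasse_term_bound u j Hu) as [K [a [HK [Ha H]]]].
  set (Z := Series (fun n => Rpower (INR n + 1) (- (1 + a)))).
  apply (is_lim_seq_0_bound _ (fun k => (K * Z) * Rpower (INR k + 1) (- a)));
    [|apply is_lim_seq_0_scal, Rpower_neg_lim, Ha].
  intros k. assert (Hk := pos_INR k).
  rewrite (Series_incr_1 _ (ex_series_hasse (u + INR k) j ltac:(lra))).
  unfold hasse_term at 1. simpl (INR (fact 0)). simpl (INR 0). cbn [ndiff].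
  match goal with |- Rabs (?p - (?q + ?s)) <= _ =>
    replace (p - (q + s)) with (- s) by field end.
  rewrite Rabs_Ropp.
  assert (Hex : ex_series (fun n => K * Rpower (INR k + 1) (- a) * Rpower (INR n + 1) (- (1 + a)))).
  { apply (ex_series_Rmult (K * Rpower (INR k + 1) (- a))), ex_series_Rpower, Ha. }
  eapply Rle_trans; [apply Series_Rabs|].
  - apply (ex_series_dominated _ _ (fun n => eq_ind_r (fun z => z <= _) (H k n) (Rabs_Rabsolu _)) Hex).
  - eapply Rle_trans; [apply Series_le; [|exact Hex]|].
    + intros n. split; [apply Rabs_pos|apply H].
    + rewrite Series_scal_l. apply Req_le. unfold Z. ring.
Qed.

(* [Series (em_term f df u) + f u] is the limit of [f (u + K) - \sum_(k < K) df (u + k)]. *)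
Definition em_term (f df : R -> R) (u : R) (k : nat) : R :=
  f (u + INR k + 1) - f (u + INR k) - df (u + INR k).

(** By [hasse_step] the summand is the increment of ln^j - S (ln^j) from u+k to u+k+1, so the series
    telescopes. *)
Lemma is_series_em_ln_pow (u : R) (j : nat) : 0 < u ->
  is_series (em_term (fun x => ln x ^ j) (ln_pow_deriv j) u)
    (Series (hasse_term j u) - ln u ^ j).
Proof.
  intros Hu.
  set (e := fun k => ln (u + INR k) ^ j - Series (hasse_term j (u + INR k))).
  replace (Series (hasse_term j u) - ln u ^ j) with (0 - e 0%nat).
  - apply (is_series_ext (fun k => e (S k) - e k)).
    + intros k. unfold e, em_term. assert (Hk := pos_INR k).
      assert (E := hasse_step (u + INR k) j ltac:(lra)).
      replace (u + INR (S k)) with (u + INR k + 1) by (rewrite S_INR; ring). lra.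
    + apply is_series_telescope, hasse_shift_lim, Hu.
  - unfold e. replace (u + INR 0) with u by (simpl; ring). ring.
Qed.

(** * Asymptotics of [e * zeta (1 + e)] as [e] tends to [0] *)

Fixpoint exp_tail (n : nat) (y : R) : R :=
  match n with
  | O => exp y
  | S n => exp_tail n y - y ^ n / INR (fact n)
  end.

Lemma is_derive_exp_tail (n : nat) (y : R) :
  is_derive (exp_tail n) y (exp_tail (pred n) y).
Proof.
  assert (H0 : forall z, is_derive exp z (exp z)).
  { intros z. apply is_derive_Reals, derivable_pt_lim_exp. }
  revert y. induction n as [|n IH]; intros y; [apply H0|].
  simpl pred. change (exp_tail (S n)) with (fun z => exp_tail n z - z ^ n / INR (fact n)).
  assert (Hf := INR_fact_neq_0 n).
  destruct n as [|n].
  - apply (is_derive_ext (fun z => exp z - 1 / 1)); [reflexivity|].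
    auto_derive; [exact I|simpl; ring].
  - change (exp_tail (S n) y) with (exp_tail n y - y ^ n / INR (fact n)).
    apply @is_derive_minus; [apply IH|].
    replace (y ^ n / INR (fact n)) with (/ INR (fact (S n)) * (INR (S n) * 1 * y ^ pred (S n))).
    + apply (is_derive_ext (fun z => / INR (fact (S n)) * z ^ S n));
        [intros; apply Rmult_comm|].
      apply is_derive_scal. apply (is_derive_pow (fun z => z)), (is_derive_id (K := R_AbsRing)).
    + simpl pred. rewrite fact_simpl, mult_INR. field.
      split; [apply INR_fact_neq_0|apply not_0_INR; lia].
Qed.

(** Repeated mean value theorem from 0, where every tail of positive order vanishes. *)
Lemma exp_tail_bound (n : nat) : forall y, Rabs (exp_tail n y) <= Rabs y ^ n * exp (Rabs y).
Proof.
  induction n as [|n IH]; intros y.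
  { simpl. rewrite Rmult_1_l, Rabs_right by apply Rle_ge, Rlt_le, exp_pos.
    apply exp_le_compat, Rle_abs. }
  assert (Z : exp_tail (S n) 0 = 0).
  { clear IH. induction n as [|n IH]; [simpl; rewrite exp_0; field|].
    change (exp_tail (S n) 0 - 0 ^ S n / INR (fact (S n)) = 0).
    rewrite IH, pow_i by lia. unfold Rdiv. ring. }
  assert (H : exists c, Rabs c <= Rabs y /\ Rabs (exp_tail (S n) y) = Rabs (exp_tail n c) * Rabs y).
  { destruct (Rle_lt_dec 0 y) as [Hy|Hy].
    - destruct (mean_value (exp_tail (S n)) (exp_tail n) 0 y Hy) as [c [Hc E]].
      { intros x _. apply (is_derive_exp_tail (S n)). }
      exists c. rewrite !(Rabs_right c), !(Rabs_right y) by lra. split; [lra|].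
      rewrite Z in E. replace (exp_tail (S n) y) with (exp_tail n c * y) by lra.
      rewrite Rabs_mult, (Rabs_right y) by lra. reflexivity.
    - destruct (mean_value (exp_tail (S n)) (exp_tail n) y 0) as [c [Hc E]]; [lra| |].
      { intros x _. apply (is_derive_exp_tail (S n)). }
      exists c. rewrite (Rabs_left1 c), (Rabs_left1 y) at 1 by lra. split; [lra|].
      rewrite Z in E. replace (exp_tail (S n) y) with (exp_tail n c * y) by lra.
      apply Rabs_mult. }
  destruct H as [c [Hc E]]. rewrite E.
  apply Rle_trans with ((Rabs y ^ n * exp (Rabs y)) * Rabs y); [|simpl; apply Req_le; ring].
  apply Rmult_le_compat_r; [apply Rabs_pos|].
  eapply Rle_trans; [apply IH|].
  apply Rmult_le_compat; [apply pow_le, Rabs_pos|apply Rlt_le, exp_pos| |apply exp_le_compat, Hc].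
  apply pow_incr. split; [apply Rabs_pos|exact Hc].
Qed.

(* Taylor remainder in [e] of [x ^ (- e)], and its derivative in [x]. *)
Definition pow_tail (e : R) (n : nat) (x : R) : R := exp_tail n (- e * ln x).

Definition pow_tail_deriv (e : R) (n : nat) (x : R) : R :=
  exp_tail (pred n) (- e * ln x) * (- e / x).

Lemma is_derive_pow_tail (e : R) (n : nat) (x : R) : 0 < x ->
  is_derive (pow_tail e n) x (pow_tail_deriv e n x).
Proof.
  intros Hx. unfold pow_tail_deriv.
  replace (exp_tail (pred n) (- e * ln x) * (- e / x))
    with (scal (- e / x) (exp_tail (pred n) (- e * ln x))) by (apply Rmult_comm).
  apply (is_derive_comp (exp_tail n) (fun z => - e * ln z)).
  - apply is_derive_exp_tail.
  - auto_derive; [exact Hx|field; lra].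
Qed.

(** Each derivative of the tail in x trades one order for a factor e, so starting from order n+2
    both terms remain of size e^(n+2). *)
Lemma is_derive_pow_tail_deriv (e : R) (n : nat) (x : R) : 0 < x ->
  is_derive (pow_tail_deriv e (S (S n))) x
    ((exp_tail n (- e * ln x) * (e * e) + exp_tail (S n) (- e * ln x) * e) / (x * x)).
Proof.
  intros Hx.
  replace ((exp_tail n (- e * ln x) * (e * e) + exp_tail (S n) (- e * ln x) * e) / (x * x))
    with (plus (mult (pow_tail_deriv e (S n) x) (- e / x))
            (mult (pow_tail e (S n) x) (e / (x * x)))).
  - apply (is_derive_mult (pow_tail e (S n)) (fun z => - e / z) x).
    + apply is_derive_pow_tail, Hx.
    + auto_derive; [lra|field; lra].
    + exact Rmult_comm.
  - unfold plus, mult; simpl. unfold pow_tail_deriv, pow_tail. simpl pred. simpl exp_tail. field.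
    split; [apply INR_fact_neq_0|lra].
Qed.

Lemma pow_le_exp_quarter (p : nat) : exists K, 0 < K /\ forall t, 0 <= t -> t ^ p <= K * exp (t / 4).
Proof.
  destruct (ln_pow_le_Rpower 0 p ltac:(lra) (/ 4) ltac:(lra)) as [K [HK H]].
  exists K. split; [exact HK|]. intros t Ht.
  assert (Ht1 : 1 <= exp t) by (rewrite <- exp_0; apply exp_le_compat, Ht).
  specialize (H (exp t) Ht1). unfold Rpower in H. rewrite ln_exp in H.
  replace (t / 4) with (/ 4 * t) by field.
  eapply Rle_trans; [|exact H]. apply pow_incr. lra.
Qed.

(** With t = |ln x|, both t^q and exp (e t) are at most a constant times exp (t/4), the latter
    because e <= 1/4. Their product is of order (k+1)^(1/2), and dividing by x^2 leaves the summable
    exponent - (1 + 1/2). *)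
Lemma pow_tail_deriv2_bound (u : R) (n : nat) : 0 < u -> exists K, 0 < K /\
  forall e k x, 0 < e <= / 4 -> u + INR k <= x <= u + INR k + 1 ->
  Rabs ((exp_tail n (- e * ln x) * (e * e) + exp_tail (S n) (- e * ln x) * e) / (x * x))
  <= e ^ S (S n) * (K * Rpower (INR k + 1) (- (1 + / 2))).
Proof.
  intros Hu.
  destruct (pow_le_exp_quarter n) as [K1 [HK1 H1]].
  destruct (pow_le_exp_quarter (S n)) as [K2 [HK2 H2]].
  set (A := Rabs (ln u) + ln (1 + u) + ln 2).
  set (d := Rmin u 1).
  assert (Hd : 0 < d <= 1).
  { unfold d. split; [apply Rmin_glb_lt; lra|apply Rmin_r]. }
  assert (Hdu : d <= u) by apply Rmin_l.
  assert (Hid : 0 < / d) by (apply Rinv_0_lt_compat; lra).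
  assert (HA := exp_pos (A / 2)).
  exists ((K1 + K2) * exp (A / 2) * (/ d * / d)).
  split; [repeat apply Rmult_lt_0_compat; lra|].
  intros e k x He Hx. assert (Hk := pos_INR k).
  set (t := Rabs (ln x)).
  assert (Ht : 0 <= t) by apply Rabs_pos.
  assert (Hy : Rabs (- e * ln x) = e * t).
  { rewrite Rabs_mult, Rabs_Ropp, (Rabs_right e) by lra. reflexivity. }
  assert (Hexp : exp (e * t) <= exp (t / 4)).
  { apply exp_le_compat. replace (t / 4) with (/ 4 * t) by field.
    apply Rmult_le_compat_r; lra. }
  assert (He0 : 0 < exp (t / 4)) by apply exp_pos.
  assert (Hen : forall q, 0 <= e ^ q) by (intros; apply pow_le; lra).
  assert (B : forall q K, t ^ q <= K * exp (t / 4) ->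
     Rabs (exp_tail q (- e * ln x)) <= e ^ q * (K * (exp (t / 4) * exp (t / 4)))).
  { intros q K Hq. eapply Rle_trans; [apply exp_tail_bound|]. rewrite Hy, Rpow_mult_distr.
    rewrite (Rmult_assoc (e ^ q)). apply Rmult_le_compat_l; [apply Hen|].
    rewrite <- Rmult_assoc. apply Rmult_le_compat; [apply pow_le, Ht|apply Rlt_le, exp_pos|exact Hq|exact Hexp]. }
  assert (B1 := B n K1 (H1 t Ht)). assert (B2 := B (S n) K2 (H2 t Ht)). clear B.
  assert (Hee : exp (t / 4) * exp (t / 4) <= exp (A / 2) * Rpower (INR k + 1) (/ 2)).
  { unfold Rpower. rewrite <- !exp_plus. apply exp_le_compat.
    assert (L := ln_interval_bound u x (S k) Hu). rewrite S_INR in L.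
    assert (L' := L ltac:(lra)).
    assert (ln (INR k + 1 + 1) <= ln 2 + ln (INR k + 1)).
    { rewrite <- ln_mult by lra. apply ln_le; lra. }
    fold t in L'. unfold A. lra. }
  assert (Hix : / (x * x) <= (/ d * / d) * Rpower (INR k + 1) (- (2))).
  { rewrite Rpower_Ropp. change 2 with (INR 2). rewrite Rpower_pow by lra.
    rewrite <- !Rinv_mult. apply Rinv_le_contravar.
    - apply Rmult_lt_0_compat; [apply Rmult_lt_0_compat; lra|apply pow_lt; lra].
    - assert (Hdx : d * (INR k + 1) <= x).
      { assert (d * INR k <= 1 * INR k) by (apply Rmult_le_compat_r; lra). lra. }
      replace (d * d * (INR k + 1) ^ 2) with ((d * (INR k + 1)) * (d * (INR k + 1))) by ring.
      apply Rmult_le_compat; try exact Hdx; apply Rmult_le_pos; lra. }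
  assert (Hx0 : 0 < / (x * x)) by (apply Rinv_0_lt_compat, Rmult_lt_0_compat; lra).
  unfold Rdiv. rewrite Rabs_mult, (Rabs_right (/ (x * x))) by lra.
  apply Rle_trans with ((e ^ S (S n) * ((K1 + K2) * (exp (A / 2) * Rpower (INR k + 1) (/ 2))))
    * ((/ d * / d) * Rpower (INR k + 1) (- (2)))).
  - apply Rmult_le_compat; [apply Rabs_pos|lra| |exact Hix].
    apply Rle_trans with (e ^ S (S n) * ((K1 + K2) * (exp (t / 4) * exp (t / 4)))).
    + eapply Rle_trans; [apply Rabs_triang|].
      rewrite !Rabs_mult, (Rabs_right e) by lra.
      apply (Rmult_le_compat_r (e * e)) in B1; [|apply Rmult_le_pos; lra].
      apply (Rmult_le_compat_r e) in B2; [|lra]. simpl pow in *. lra.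
    + apply Rmult_le_compat_l; [apply Hen|]. apply Rmult_le_compat_l; [lra|exact Hee].
  - apply Req_le. replace (- (1 + / 2)) with (/ 2 + - (2)) by field.
    rewrite Rpower_plus. unfold Rdiv. ring.
Qed.

(** Two mean value steps: f (y+1) - f y - f' y = f' c - f' y = f'' c' (c - y), with 0 <= c - y <=
    1. *)
Lemma em_pow_tail_bound (u : R) (n : nat) : 0 < u -> exists K, 0 < K /\
  forall e k, 0 < e <= / 4 ->
  Rabs (em_term (pow_tail e (S (S n))) (pow_tail_deriv e (S (S n))) u k)
  <= e ^ S (S n) * (K * Rpower (INR k + 1) (- (1 + / 2))).
Proof.
  intros Hu. destruct (pow_tail_deriv2_bound u n Hu) as [K [HK H]].
  exists K. split; [exact HK|]. intros e k He. assert (Hk := pos_INR k).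
  unfold em_term.
  destruct (mean_value (pow_tail e (S (S n))) (pow_tail_deriv e (S (S n)))
    (u + INR k) (u + INR k + 1)) as [c [Hc E]]; [lra| |].
  { intros x Hx. apply is_derive_pow_tail. lra. }
  edestruct (mean_value (pow_tail_deriv e (S (S n)))
    (fun x => (exp_tail n (- e * ln x) * (e * e) + exp_tail (S n) (- e * ln x) * e) / (x * x))
    (u + INR k) c) as [c' [Hc' E']]; [lra| |].
  { intros x Hx. apply is_derive_pow_tail_deriv. lra. }
  cbv beta in E'. rewrite E.
  replace (u + INR k + 1 - (u + INR k)) with 1 by ring. rewrite Rmult_1_r, E', Rabs_mult.
  specialize (H e k c' He ltac:(lra)).
  eapply Rle_trans; [|exact H].
  rewrite <- Rmult_1_r. apply Rmult_le_compat_l; [apply Rabs_pos|].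
  rewrite Rabs_right; lra.
Qed.

Fixpoint psum (d : nat -> R) (n : nat) (x : R) : R :=
  match n with
  | O => 0
  | S n => psum d n x + d n * x ^ n
  end.

Definition hasse_coef (u : R) (j : nat) : R :=
  (-1) ^ j / INR (fact j) * Series (hasse_term j u).

Lemma is_series_em_pow_tail (u e Z : R) : 0 < u -> 0 < e ->
  is_series (fun n => Rpower (u + INR n) (- (1 + e))) Z ->
  forall n, is_series (em_term (pow_tail e n) (pow_tail_deriv e n) u)
    (e * Z - psum (hasse_coef u) n e - pow_tail e n u).
Proof.
  intros Hu He HZ n. induction n as [|n IH].
  - simpl psum.
    set (g := fun k => pow_tail e 0 (u + INR k)).
    replace (e * Z - 0 - pow_tail e 0 u) with ((0 - g 0%nat) + e * Z)
      by (unfold g; replace (u + INR 0) with u by (simpl; ring); ring).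
    apply (is_series_ext (fun k => (g (S k) - g k) + e * Rpower (u + INR k) (- (1 + e)))).
    { intros k. assert (Hk := pos_INR k). unfold g, em_term, pow_tail, pow_tail_deriv.
      replace (u + INR (S k)) with (u + INR k + 1) by (rewrite S_INR; ring).
      simpl exp_tail.
      replace (- (1 + e)) with (- e + - (1)) by ring. rewrite Rpower_plus, (Rpower_Ropp _ 1), Rpower_1 by lra.
      unfold Rpower.
      match goal with |- ?a = ?b => change (@eq R a b) end. field. lra. }
    apply @is_series_plus.
    + apply is_series_telescope. unfold g, pow_tail. simpl exp_tail.
      apply (is_lim_seq_0_bound _ (fun k => Rpower (Rmin u 1) (- e) * Rpower (INR k + 1) (- e)));
        [|apply is_lim_seq_0_scal, Rpower_neg_lim, He].
      intros k. assert (Hk := pos_INR k).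
      rewrite Rabs_right by apply Rle_ge, Rlt_le, exp_pos.
      change (Rpower (u + INR k) (- e) <= Rpower (Rmin u 1) (- e) * Rpower (INR k + 1) (- e)).
      assert (Hd : 0 < Rmin u 1) by (apply Rmin_glb_lt; lra).
      rewrite Rpower_mult_distr by lra. rewrite !Rpower_Ropp.
      apply Rinv_le_contravar; [apply Rpower_pos|]. apply Rle_Rpower_l; [lra|].
      split; [apply Rmult_lt_0_compat; lra|].
      assert (Rmin u 1 <= u) by apply Rmin_l.
      assert (Rmin u 1 * INR k <= 1 * INR k) by (apply Rmult_le_compat_r; [lra|apply Rmin_r]). lra.
    + apply (@is_series_scal R_AbsRing R_NormedModule e), HZ.
  - assert (Hf := INR_fact_neq_0 n).
    (* Raising the order from n to n+1 adds [q] times ln^n to the tail, whose series is given by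
       [is_series_em_ln_pow]. *)
    set (q := - ((- e) ^ n / INR (fact n))).
    assert (Hq : (- e) ^ n = (-1) ^ n * e ^ n).
    { replace (- e) with (-1 * e) by ring. apply Rpow_mult_distr. }
    replace (e * Z - psum (hasse_coef u) (S n) e - pow_tail e (S n) u)
      with ((e * Z - psum (hasse_coef u) n e - pow_tail e n u)
            + q * (Series (hasse_term n u) - ln u ^ n)).
    2:{ unfold pow_tail. simpl psum. simpl exp_tail. unfold hasse_coef, q.
        rewrite Rpow_mult_distr, Hq. field. exact Hf. }
    apply (is_series_ext (fun k => em_term (pow_tail e n) (pow_tail_deriv e n) u k
       + q * em_term (fun x => ln x ^ n) (ln_pow_deriv n) u k)).
    { intros k. assert (Hk := pos_INR k). unfold em_term.
      assert (P : forall x, pow_tail e (S n) x = pow_tail e n x + q * ln x ^ n).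
      { intros x. unfold pow_tail, q. simpl exp_tail. rewrite Rpow_mult_distr. field. exact Hf. }
      assert (D : forall x, 0 < x -> pow_tail_deriv e (S n) x
         = pow_tail_deriv e n x + q * ln_pow_deriv n x).
      { intros x Hx. unfold pow_tail_deriv, q. simpl pred. destruct n as [|n].
        - simpl. field. lra.
        - cbn [pred exp_tail ln_pow_deriv]. rewrite fact_simpl, mult_INR, Rpow_mult_distr.
          simpl pow. field. split; [lra|]. split; [apply INR_fact_neq_0|apply not_0_INR; lia]. }
      rewrite !P, D by lra.
      match goal with |- ?a = ?b => change (@eq R a b) end. ring. }
    apply @is_series_plus; [exact IH|].
    apply (@is_series_scal R_AbsRing R_NormedModule q), is_series_em_ln_pow, Hu.
Qed.

Lemma hurwitz_asymptotic (u : R) (n : nat) : 0 < u -> exists K,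
  forall e Z, 0 < e <= / 4 ->
  is_series (fun n => Rpower (u + INR n) (- (1 + e))) Z ->
  Rabs (e * Z - psum (hasse_coef u) (S (S n)) e) <= K * e ^ S (S n).
Proof.
  intros Hu. destruct (em_pow_tail_bound u n Hu) as [K [HK H]].
  set (W := Series (fun k => Rpower (INR k + 1) (- (1 + / 2)))).
  exists (K * W + Rabs (ln u) ^ S (S n) * exp (Rabs (ln u))).
  intros e Z He HZ.
  assert (HS := is_series_em_pow_tail u e Z Hu ltac:(lra) HZ (S (S n))).
  apply is_series_unique in HS.
  set (T := em_term (pow_tail e (S (S n))) (pow_tail_deriv e (S (S n))) u) in *.
  assert (Hex : ex_series (fun k => e ^ S (S n) * (K * Rpower (INR k + 1) (- (1 + / 2))))).
  { apply ex_series_Rmult, ex_series_Rmult, ex_series_Rpower. lra. }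
  assert (HT : Rabs (Series T) <= e ^ S (S n) * (K * W)).
  { eapply Rle_trans; [apply Series_Rabs|].
    - apply (ex_series_dominated _ (fun k => e ^ S (S n) * (K * Rpower (INR k + 1) (- (1 + / 2)))));
        [|exact Hex].
      intros k. rewrite Rabs_Rabsolu. apply H, He.
    - eapply Rle_trans; [apply Series_le; [|exact Hex]|].
      + intros k. split; [apply Rabs_pos|apply H, He].
      + rewrite !Series_scal_l. apply Req_le. reflexivity. }
  assert (HP : Rabs (pow_tail e (S (S n)) u)
     <= e ^ S (S n) * (Rabs (ln u) ^ S (S n) * exp (Rabs (ln u)))).
  { unfold pow_tail. eapply Rle_trans; [apply exp_tail_bound|].
    rewrite Rabs_mult, Rabs_Ropp, (Rabs_right e), Rpow_mult_distr, Rmult_assoc by lra.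
    apply Rmult_le_compat_l; [apply pow_le; lra|].
    apply Rmult_le_compat_l; [apply pow_le, Rabs_pos|]. apply exp_le_compat.
    assert (e * Rabs (ln u) <= 1 * Rabs (ln u)) by (apply Rmult_le_compat_r; [apply Rabs_pos|lra]).
    lra. }
  replace (e * Z - psum (hasse_coef u) (S (S n)) e)
    with (Series T + pow_tail e (S (S n)) u) by lra.
  eapply Rle_trans; [apply Rabs_triang|]. lra.
Qed.

(** * Identification of the Laurent coefficients *)

Lemma psum_head (d : nat -> R) (n : nat) (x : R) :
  psum d (S n) x = d 0%nat + x * psum (fun j => d (S j)) n x.
Proof.
  induction n as [|n IH]; [simpl; ring|].
  change (psum d (S (S n)) x) with (psum d (S n) x + d (S n) * x ^ S n).
  rewrite IH. simpl. ring.
Qed.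

Lemma psum_continuous (d : nat -> R) (n : nat) (x : R) : continuity_pt (psum d n) x.
Proof.
  induction n as [|n IH].
  - apply continuity_pt_const. intros y z. reflexivity.
  - change (psum d (S n)) with (fun x => psum d n x + d n * x ^ n).
    apply (continuity_pt_plus (psum d n) (fun x => d n * x ^ n)); [exact IH|].
    apply derivable_continuous_pt. exists (d n * (INR n * 1 * x ^ pred n)).
    apply is_derive_Reals. apply is_derive_scal.
    apply (is_derive_pow (fun z => z)), (is_derive_id (K := R_AbsRing)).
Qed.

(** A comparison on the right of 0 suffices: the constant terms agree by continuity at 0, and
    dividing the error by x passes to the shifted coefficients. *)
Lemma pseries_coef_unique (n : nat) : forall (b d : nat -> R) (K r : R),
  Rbar_lt 0 (CV_radius b) -> 0 < r ->
  (forall x, 0 < x < r -> Rabs (PSeries b x - psum d n x) <= K * x ^ n) ->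
  forall j, (j < n)%nat -> b j = d j.
Proof.
  induction n as [|n IH]; intros b d K r Hb Hr H j Hj; [lia|].
  assert (E0 : b 0%nat = d 0%nat).
  { set (G := fun x => PSeries b x - psum d (S n) x).
    assert (C : continuity_pt G 0).
    { apply continuity_pt_minus; [|apply psum_continuous].
      apply PSeries_continuity. rewrite Rabs_R0. exact Hb. }
    (* The bound by 1 gives x^(n+1) <= x, and the 2 in [v] keeps the points strictly below [r']. *)
    set (r' := Rmin r 1).
    assert (Hr' : 0 < r') by (apply Rmin_glb_lt; lra).
    set (v := fun k => r' * / (2 + INR k)).
    assert (Hv : forall k, 0 < v k < r').
    { intros k. assert (Hk := pos_INR k). unfold v. split.
      - apply Rmult_lt_0_compat; [exact Hr'|]. apply Rinv_0_lt_compat. lra.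
      - rewrite <- (Rmult_1_r r') at 2. apply Rmult_lt_compat_l; [exact Hr'|].
        rewrite <- Rinv_1. apply Rinv_lt_contravar; lra. }
    assert (Hv0 : is_lim_seq v 0).
    { apply is_lim_seq_0_scal, is_lim_seq_inv_shift. }
    assert (L1 := is_lim_seq_continuous G v 0 C Hv0).
    assert (HK : 0 <= K).
    { assert (H0 := Hv 0%nat). assert (Hm : r' <= r) by apply Rmin_l.
      specialize (H (v 0%nat) ltac:(lra)).
      assert (0 < v 0%nat ^ S n) by (apply pow_lt; lra).
      assert (Hp := Rle_trans _ _ _ (Rabs_pos _) H).
      apply (Rmult_le_reg_r (v 0%nat ^ S n)); lra. }
    assert (L2 : is_lim_seq (fun k => G (v k)) 0).
    { apply (is_lim_seq_0_bound _ (fun k => K * v k)); [|apply is_lim_seq_0_scal, Hv0].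
      intros k. assert (Hk := Hv k).
      assert (Hm1 : r' <= r) by apply Rmin_l. assert (Hm2 : r' <= 1) by apply Rmin_r.
      eapply Rle_trans; [apply H; lra|].
      apply Rmult_le_compat_l; [exact HK|]. simpl.
      apply Rle_trans with (v k * 1); [|lra]. apply Rmult_le_compat_l; [lra|].
      rewrite <- (pow1 n). apply pow_incr. lra. }
    apply is_lim_seq_unique in L1. apply is_lim_seq_unique in L2.
    rewrite L1 in L2. injection L2. unfold G.
    rewrite PSeries_0, psum_head. lra. }
  destruct j as [|j]; [exact E0|].
  (* The interval is cut at the radius of convergence, inside which the first coefficient may be
     split off from [PSeries b]. *)
  apply (IH (PS_decr_1 b) (fun j => d (S j)) K
    (match CV_radius b with Finite s => Rmin r s | _ => r end)).
  - rewrite CV_radius_decr_1. exact Hb.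
  - destruct (CV_radius b); try exact Hr. apply Rmin_glb_lt; [exact Hr|exact Hb].
  - intros x Hx.
    assert (Hxr : 0 < x < r /\ Rbar_lt (Rabs x) (CV_radius b)).
    { destruct (CV_radius b) as [s| |].
      - generalize (Rmin_l r s) (Rmin_r r s). intros.
        split; [lra|]. simpl. rewrite Rabs_right; lra.
      - split; [exact Hx|exact I].
      - destruct Hb. }
    destruct Hxr as [Hxr Hxs].
    specialize (H x Hxr). rewrite psum_head, PSeries_decr_1, E0 in H by (apply CV_radius_inside, Hxs).
    set (D := PSeries (PS_decr_1 b) x - psum (fun j => d (S j)) n x) in *.
    match type of H with Rabs ?A <= _ => replace A with (x * D) in H by (unfold D; ring) end.
    rewrite Rabs_mult, (Rabs_right x) in H by lra. simpl pow in H.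
    apply (Rmult_le_reg_l x); lra.
  - lia.
Qed.

Lemma CV_radius_pos (a : nat -> R) (x : R) : 0 < x -> ex_pseries a x -> Rbar_lt 0 (CV_radius a).
Proof.
  intros Hx H. apply ex_pseries_R, ex_series_lim_0 in H.
  destruct (Rbar_lt_le_dec 0 (CV_radius a)) as [L|L]; [exact L|].
  exfalso. revert H. apply CV_disk_outside.
  eapply Rbar_le_lt_trans; [exact L|]. simpl. rewrite Rabs_right; lra.
Qed.

(** * From the complex Laurent expansion to real series *)

Lemma is_series_C_components (a : nat -> C) (l : C) :
  @is_series C_AbsRing C_NormedModule a l ->
  is_series (fun n => fst (a n)) (fst l) /\ is_series (fun n => snd (a n)) (snd l).
Proof.
  intros H.
  assert (S1 : forall n, fst (@sum_n C_AbelianMonoid a n) = sum_n (fun n => fst (a n)) n).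
  { induction n as [|n IH]; [rewrite !sum_O; reflexivity|].
    rewrite !sum_Sn, <- IH. reflexivity. }
  assert (S2 : forall n, snd (@sum_n C_AbelianMonoid a n) = sum_n (fun n => snd (a n)) n).
  { induction n as [|n IH]; [rewrite !sum_O; reflexivity|].
    rewrite !sum_Sn, <- IH. reflexivity. }
  split; intros P [eps HP].
  - destruct (H (fun z => P (fst z))) as [N HN].
    { exists eps. intros z [Hz _]. apply HP, Hz. }
    exists N. intros n Hn. specialize (HN n Hn). cbv beta in HN. rewrite <- S1. exact HN.
  - destruct (H (fun z => P (snd z))) as [N HN].
    { exists eps. intros z [_ Hz]. apply HP, Hz. }
    exists N. intros n Hn. specialize (HN n Hn). cbv beta in HN. rewrite <- S2. exact HN.
Qed.

Lemma Rpow_C_real (x t : R) : 0 < x -> Rpow_C x (- RtoC t)%C = RtoC (Rpower x (- t)).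
Proof.
  intros Hx. unfold Rpow_C, Cexp, RtoC, Rpower. simpl.
  replace ((- t) * 0 + - 0 * ln x) with 0 by ring.
  replace (- t * ln x - - 0 * 0) with (- t * ln x) by ring.
  rewrite cos_0, sin_0. f_equal; ring.
Qed.

Lemma pow_n_RtoC (e : R) (k : nat) : @pow_n C_AbsRing (RtoC e) k = RtoC (e ^ k).
Proof.
  induction k as [|k IH]; [reflexivity|].
  simpl. rewrite IH. unfold mult; simpl. rewrite <- RtoC_mult. reflexivity.
Qed.

(** On the ray s = 1 + e with e > 0, zeta is the sum of its defining series, whose terms are real.
    The Laurent expansion therefore splits into a real part and an imaginary part with sum 0. *)
Lemma stieltjes_real_expansion (u : R) (gamma : nat -> C) :
  0 < u -> is_stieltjes_constants u gamma ->
  exists r, 0 < r /\ forall e, 0 < e < r -> exists Z,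
    is_series (fun n => Rpower (u + INR n) (- (1 + e))) Z /\
    is_pseries (fun p => (-1) ^ p / INR (fact p) * fst (gamma p)) e (Z - / e) /\
    is_pseries (fun p => (-1) ^ p / INR (fact p) * snd (gamma p)) e 0.
Proof.
  intros Hu [zeta [[_ Hz] [eps HL]]].
  exists eps. split; [apply cond_pos|]. intros e He.
  specialize (HL (RtoC (1 + e))).
  assert (Hball : @ball C_UniformSpace (RtoC 1) eps (RtoC (1 + e))).
  { split; simpl.
    - change (Rabs (1 + e - 1) < eps). rewrite Rabs_right; lra.
    - change (Rabs (0 - 0) < eps). rewrite Rminus_0_r, Rabs_R0. apply cond_pos. }
  specialize (HL Hball).
  assert (Hne : RtoC (1 + e) <> RtoC 1) by (intros E; injection E; lra).
  specialize (HL Hne).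
  specialize (Hz (RtoC (1 + e)) ltac:(simpl; lra)).
  apply is_series_C_components in Hz. destruct Hz as [Hz1 Hz2].
  set (z := zeta (RtoC (1 + e))) in *.
  assert (Hp : forall n, Rpow_C (INR n + u) (- RtoC (1 + e))%C = RtoC (Rpower (u + INR n) (- (1 + e)))).
  { intros n. assert (Hn := pos_INR n). rewrite Rpow_C_real by lra. rewrite (Rplus_comm u). reflexivity. }
  assert (Hsnd : snd z = 0).
  { apply is_series_unique in Hz2. rewrite <- Hz2.
    rewrite (Series_ext _ (fun n => 0 * 0)).
    - rewrite Series_scal_l. ring.
    - intros n. rewrite Hp. simpl. ring. }
  exists (fst z). split.
  { apply (is_series_ext (fun n => fst (Rpow_C (INR n + u) (- RtoC (1 + e))%C))); [|exact Hz1].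
    intros n. rewrite Hp. reflexivity. }
  assert (Es : (RtoC (1 + e) - RtoC 1)%C = RtoC e).
  { rewrite <- RtoC_minus. f_equal. ring. }
  rewrite Es in HL. apply is_series_C_components in HL. destruct HL as [H1 H2].
  assert (Ei : (z - 1 / RtoC e)%C = (fst z - / e, 0)).
  { rewrite <- RtoC_div by lra. unfold Cminus, Cplus, Copp, RtoC. simpl. rewrite Hsnd. f_equal; field; lra. }
  rewrite Ei in H1, H2. simpl (fst (_, _)) in H1. simpl (snd (_, _)) in H2.
  split; apply is_pseries_R.
  - eapply is_series_ext; [|exact H1]. intros n. cbv beta. rewrite pow_n_RtoC.
    change (fst (RtoC (e ^ n) * (RtoC ((-1) ^ n / INR (fact n)) * gamma n))%C
      = (-1) ^ n / INR (fact n) * fst (gamma n) * e ^ n).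
    unfold Cmult, RtoC. simpl. ring.
  - eapply is_series_ext; [|exact H2]. intros n. cbv beta. rewrite pow_n_RtoC.
    change (snd (RtoC (e ^ n) * (RtoC ((-1) ^ n / INR (fact n)) * gamma n))%C
      = (-1) ^ n / INR (fact n) * snd (gamma n) * e ^ n).
    unfold Cmult, RtoC. simpl. ring.
Qed.

(** The power series of imaginary parts vanishes on (0, r), hence so do its coefficients. *)
Lemma stieltjes_real (u : R) (gamma : nat -> C) (m : nat) :
  0 < u -> is_stieltjes_constants u gamma -> snd (gamma m) = 0.
Proof.
  intros Hu Hg. destruct (stieltjes_real_expansion u gamma Hu Hg) as [r [Hr H]].
  set (b := fun p => (-1) ^ p / INR (fact p) * snd (gamma p)) in *.
  assert (Hb : b m = 0).
  { apply (pseries_coef_unique (S m) b (fun _ => 0) 0 r); [| exact Hr| |lia].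
    - destruct (H (r / 2) ltac:(lra)) as [Z [_ [_ HZ]]].
      apply (CV_radius_pos b (r / 2)); [lra|]. exists 0. exact HZ.
    - intros x Hx. destruct (H x Hx) as [Z [_ [_ HZ]]].
      apply is_pseries_unique in HZ. rewrite HZ.
      replace (psum (fun _ => 0) (S m) x) with 0.
      + rewrite Rminus_0_r, Rabs_R0. lra.
      + induction (S m) as [|n IH]; [reflexivity|]. simpl. rewrite <- IH. ring. }
  unfold b in Hb. apply Rmult_integral in Hb. destruct Hb as [Hb|Hb]; [|exact Hb].
  exfalso. revert Hb. apply Rmult_integral_contrapositive_currified.
  - apply pow_nonzero. lra.
  - apply Rinv_neq_0_compat, INR_fact_neq_0.
Qed.

Lemma stieltjes_hasse (u : R) (gamma : nat -> C) (m : nat) :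
  0 < u -> is_stieltjes_constants u gamma ->
  fst (gamma m) = - (1 / (INR m + 1)) * Series (hasse_term (S m) u).
Proof.
  intros Hu Hg. destruct (stieltjes_real_expansion u gamma Hu Hg) as [r [Hr H]].
  destruct (hurwitz_asymptotic u m Hu) as [K HK].
  set (c := fun p => (-1) ^ p / INR (fact p) * fst (gamma p)) in *.
  (* The Taylor coefficients at [e = 0] of [e * zeta (1 + e)]. *)
  set (b := fun p => match p with O => 1 | S q => c q end).
  assert (Hc : Rbar_lt 0 (CV_radius c)).
  { destruct (H (r / 2) ltac:(lra)) as [Z [_ [HZ _]]].
    apply (CV_radius_pos c (r / 2)); [lra|]. eexists. exact HZ. }
  assert (Hb : Rbar_lt 0 (CV_radius b)) by (rewrite <- CV_radius_decr_1; exact Hc).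
  assert (E : b (S m) = hasse_coef u (S m)).
  (* Multiplying the expansion by e shifts the indices, so gamma m sits at index m+1; an error of
     order e^(m+2) is what determines that coefficient. *)
  { apply (pseries_coef_unique (S (S m)) b (hasse_coef u) K (Rmin r (/ 4))); [exact Hb| | |lia].
    - apply Rmin_glb_lt; lra.
    - intros x Hx.
      assert (x < r) by (eapply Rlt_le_trans; [apply Hx|apply Rmin_l]).
      assert (x < / 4) by (eapply Rlt_le_trans; [apply Hx|apply Rmin_r]).
      destruct (H x ltac:(lra)) as [Z [HZ [Hp _]]].
      replace (PSeries b x) with (x * Z); [apply HK; [lra|exact HZ]|].
      rewrite PSeries_decr_1.
      + change (PS_decr_1 b) with c. apply is_pseries_unique in Hp. rewrite Hp.
        simpl. field. lra.
      + apply ex_pseries_R, ex_series_incr_1.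
        apply (ex_series_ext (fun k => x * (c k * x ^ k))); [intros k; simpl; ring|].
        apply ex_series_Rmult, ex_pseries_R. eexists; exact Hp. }
  unfold b, c, hasse_coef in E.
  assert (Hm := pos_INR m).
  assert (Hf := INR_fact_neq_0 m).
  assert (Hs : (-1) ^ m <> 0) by (apply pow_nonzero; lra).
  apply (Rmult_eq_reg_l ((-1) ^ m / INR (fact m))).
  - rewrite E, fact_simpl, mult_INR, S_INR. simpl pow. field. lra.
  - apply Rmult_integral_contrapositive_currified; [exact Hs|apply Rinv_neq_0_compat, Hf].
Qed.

Theorem mainTheorem1 (m : nat) (u : R) (gamma : nat -> C)
    (hu : 0 < u) (hgamma : is_stieltjes_constants u gamma) :
  let a := fun n : nat =>
    1 / (INR n + 1) *
    sum_n (fun k : nat =>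
             Binomial.C n k * (-1) ^ k * (ln (u + INR k)) ^ (m + 1)) n in
  ex_series a /\ gamma m = RtoC (- (1 / (INR m + 1)) * Series a).
Proof.
  intros a.
  assert (E : forall n, hasse_term (S m) u n = a n).
  { intros n. unfold a, hasse_term. rewrite ndiff_binomial, sum_n_Reals, Nat.add_1_r.
    unfold Rdiv. ring. }
  split.
  - apply (ex_series_ext _ _ E), ex_series_hasse, hu.
  - rewrite <- (Series_ext _ _ E).
    rewrite <- (stieltjes_hasse u gamma m hu hgamma).
    generalize (stieltjes_real u gamma m hu hgamma). destruct (gamma m) as [x y].
    simpl. intros ->. reflexivity.
Qed.
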